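(* Let $f:\mathcal C\times\mathbb R^m\to\mathbb R^n$ be Lipschitz on bounded sets with $f(0,0)=0$, let $\mathcal D:\mathcal C\to\mathbb R^n$, $\mathcal D\phi=\phi(0)-\sum_{j=1}^pA_j\phi(-\Delta_j)$, be strongly stable, and suppose there exists a map $\overline f:\mathbb R^n\times\mathcal C\times\mathbb R^m\to\mathbb R^n$, independent of the second argument at $0$, such that $f(\phi,u)=\overline f(\phi(0),\phi,u)$ for all $\phi\in\mathcal C$, $u\in\mathbb R^m$. Consider the system $$\frac{d}{dt}\mathcal Dx_t=f(x_t,u(t)),\quad t\ge 0,\qquad x(\tau)=\xi_0(\tau),\ \tau\in[-\Delta,0],\ \xi_0\in\mathcal C,\qquad(\ast)$$ where $u:\mathbb R^+\to\mathbb R^m$ is a Lebesgue measurable, locally essentially bounded input signal. Let the system $(\ast)$ with $u(t)\equiv0$ be $0$-GES, and let $f$ satisfy the following hypotheses: (i) there exists a positive real $L_0$ such that, for any $\phi_1,\phi_2\in\mathcal C$, $|f(\phi_1,0)-f(\phi_2,0)|\le L_0\|\phi_1-\phi_2\|$; (ii) there exists a function $L$ of class $\mathcal K$ such that, for any $\phi\in\mathcal C$ and any $u\in\mathbb R^m$, $|f(\phi,u)-f(\phi,0)|\le L(|u|)$. Then the system $(\ast)$ is ISS.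
   Context: Notation. $\mathbb R^+=[0,+\infty)$; $|\cdot|$ is the Euclidean norm; $n,m,p$ are positive integers; $\Delta>0$ is real; $0<\Delta_j\le\Delta$ are reals and $A_j\in\mathbb R^{n\times n}$, $j=1,\dots,p$. $\mathcal C$ is the Banach space of continuous functions $[-\Delta,0]\to\mathbb R^n$ with the supremum norm $\|\cdot\|$; $\mathcal C_H=\{\psi\in\mathcal C:\|\psi\|\le H\}$. For a function $x$ on $[-\Delta,c)$ and $t\in[0,c)$, $x_t\in\mathcal C$ is $x_t(\tau)=x(t+\tau)$, $\tau\in[-\Delta,0]$. A solution of $(\ast)$ on $[0,b)$ is a continuous $x:[-\Delta,b)\to\mathbb R^n$ with $x_0=\xi_0$ such that $t\mapsto\mathcal Dx_t$ is locally absolutely continuous and satisfies the equation for almost every $t$. Inputs. For a measurable essentially bounded $v:\mathbb R^+\to\mathbb R^m$, $\|v\|$ denotes its essential supremum norm. For $0\le T_1<T_2$, $v_{[T_1,T_2)}$ equals $v$ on $[T_1,T_2)$ and $0$ elsewhere ($v_{[0,0)}$ is the zero function). $v$ is locally essentially bounded if $v_{[0,T)}$ is essentially bounded for every $T>0$. Strong stability. $\mathcal D$ is strongly stable (Hale and Lunel) if for every choice of positive delays $r_1,\dots,r_p$ the zero solution of the difference equation $y(t)=\sum_{j=1}^pA_jy(t-r_j)$ is uniformly asymptotically stable; equivalently, $\sup\{\rho(\sum_{j=1}^pA_je^{i\theta_j}):\theta_j\in[0,2\pi]\}<1$, where $\rho$ is the spectral radius. Lipschitz on bounded sets. For any $H,\delta>0$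 there is $L>0$ such that $|f(\phi_1,u_1)-f(\phi_2,u_2)|\le L(\|\phi_1-\phi_2\|+|u_1-u_2|)$ for all $\phi_1,\phi_2\in\mathcal C_H$ and all $u_1,u_2\in\mathbb R^m$ with $|u_1|,|u_2|\le\delta$. Independence at $0$. $\overline f(x,\phi,u)$ is independent of the second argument at $0$ if its dependence on $\phi$ carries no dependence on the point value $\phi(0)$, understood here in the non-atomic sense: for every $H>0$ there is a function $\kappa:(0,\Delta)\to\mathbb R^+$ with $\kappa(s)\to0$ as $s\to0^+$ such that $|\overline f(x,\phi_1,u)-\overline f(x,\phi_2,u)|\le\kappa(s)\|\phi_1-\phi_2\|$ whenever $0<s<\Delta$, $|x|\le H$, $|u|\le H$, $\phi_1,\phi_2\in\mathcal C_H$ and $\phi_1=\phi_2$ on $[-\Delta,-s]$. (In particular this holds if $\overline f(x,\phi,u)$ depends on $\phi$ only through its restriction to $[-\Delta,-s_0]$ for some $s_0>0$.) Comparison functions. A function $\gamma:\mathbb R^+\to\mathbb R^+$ is of class $\mathcal K$ if it is continuous, zero at zero and strictly increasing; of class $\mathcal L$ if it is continuous and monotonically decreases to zero as its argument tends to $+\infty$. A function $\beta:\mathbb R^+\times\mathbb R^+\to\mathbb R^+$ is of class $\mathcal{KL}$ if $\beta(\cdot,t)$ is of class $\mathcal K$ for each $t\ge0$ and $\beta(s,\cdot)$ is of class $\mathcal L$ for each $s\ge0$. 0-GES. The system $(\ast)$ with $u\equiv0$ is $0$-GES if there exist positive reals $M,\lambda$ such that, for any $\xi_0\in\mathcal C$,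 the corresponding solution exists for all $t\in\mathbb R^+$ and satisfies $|x(t)|\le Me^{-\lambda t}\|\xi_0\|$ for all $t\ge0$. ISS. The system $(\ast)$ is ISS if there exist a function $\beta$ of class $\mathcal{KL}$ and a function $\gamma$ of class $\mathcal K$ such that, for any $\xi_0\in\mathcal C$ and any Lebesgue measurable, locally essentially bounded input $u$, the corresponding solution exists for all $t\ge0$ and satisfies $|x(t)|\le\beta(\|\xi_0\|,t)+\gamma(\|u_{[0,t)}\|)$ for all $t\in\mathbb R^+$. *)

(* Defs.v *)
From HB Require Import structures.
From mathcomp Require Import all_boot all_order all_algebra.
From mathcomp Require Import all_classical all_reals all_analysis.
From mathcomp Require Import measurable_realfun ess_sup_inf.

Set Implicit Arguments.
Unset Strict Implicit.
Unset Printing Implicit Defensive.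

Import Order.TTheory GRing.Theory Num.Theory.
Import numFieldNormedType.Exports.

Local Open Scope classical_set_scope.
Local Open Scope ring_scope.

(* The library norm `|v| on matrices is the max norm, hence this one. *)
Definition enorm (R : realType) (n : nat) (v : 'cV[R]_n) : R :=
  Num.sqrt (\sum_i v i 0 ^+ 2).

(* A function on an interval is represented by a total function on R whose
   values off that interval are irrelevant.  Thus an element of
   C = C([-r, 0], R^n) is given by any phi : R -> 'cV_n satisfying [histC r],
   and [supnorm r phi] only sees phi on [-r, 0].  A functional f on C is a
   function of such representatives; the Lipschitz condition [lip_on_bounded]
   (resp. the condition [indep_at0]) forces it to take the same value at two
   representatives that agree on [-Delta, 0]. *)
Definition histC (R : realType) (n : nat) (r : R) : set (R -> 'cV[R]_n) :=
  [set phi | {within `[- r, 0], continuous phi}].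

Definition supnorm (R : realType) (n : nat) (r : R) (phi : R -> 'cV[R]_n) : R :=
  sup [set enorm (phi tau) | tau in `[- r, 0]].

Definition hist (R : realType) (n : nat) (x : R -> 'cV[R]_n) (t : R) :
    R -> 'cV[R]_n :=
  fun tau => x (t + tau).

Definition Dop (R : realType) (n p : nat) (A : 'I_p -> 'M[R]_n)
    (d : 'I_p -> R) (phi : R -> 'cV[R]_n) : 'cV[R]_n :=
  phi 0 - \sum_j A j *m phi (- d j).

(* Solutions, from time sigma on, of y(t) = \sum_j A_j y(t - r_j); the initial
   datum is y on [sigma - max_j r_j, sigma]. *)
Definition max_delay (R : realType) (p : nat) (r : 'I_p -> R) : R :=
  \big[Order.max/0]_j r j.

Definition difference_solution (R : realType) (n p : nat)
    (A : 'I_p -> 'M[R]_n) (r : 'I_p -> R) (sigma : R) (y : R -> 'cV[R]_n) :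
    Prop :=
  {within `[sigma - max_delay r, +oo[, continuous y} /\
  (forall t, sigma <= t -> y t = \sum_j A j *m y (t - r j)).

Definition uniformly_asymptotically_stable (R : realType) (n p : nat)
    (A : 'I_p -> 'M[R]_n) (r : 'I_p -> R) : Prop :=
  let nrm (y : R -> 'cV[R]_n) t := supnorm (max_delay r) (hist y t) in
  (forall e : R, 0 < e -> exists2 delta : R, 0 < delta &
     forall sigma y, difference_solution A r sigma y ->
       nrm y sigma < delta -> forall t, sigma <= t -> nrm y t < e) /\
  (exists2 delta : R, 0 < delta & forall e : R, 0 < e ->
     exists2 T : R, 0 < T &
     forall sigma y, difference_solution A r sigma y ->
       nrm y sigma < delta -> forall t, sigma + T <= t -> nrm y t < e).

(* A condition on the matrices only: the actual delays play no role. *)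
Definition strongly_stable (R : realType) (n p : nat)
    (A : 'I_p -> 'M[R]_n) : Prop :=
  forall r : 'I_p -> R, (forall j, 0 < r j) ->
    uniformly_asymptotically_stable A r.

Definition lip_on_bounded (R : realType) (n m : nat) (Delta : R)
    (f : (R -> 'cV[R]_n) -> 'cV[R]_m -> 'cV[R]_n) : Prop :=
  forall H delta : R, 0 < H -> 0 < delta -> exists2 L : R, 0 < L &
    forall phi1 phi2 u1 u2,
      histC Delta phi1 -> histC Delta phi2 ->
      supnorm Delta phi1 <= H -> supnorm Delta phi2 <= H ->
      enorm u1 <= delta -> enorm u2 <= delta ->
      enorm (f phi1 u1 - f phi2 u2) <=
        L * (supnorm Delta (phi1 \- phi2) + enorm (u1 - u2)).

Definition indep_at0 (R : realType) (n m : nat) (Delta : R)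
    (fbar : 'cV[R]_n -> (R -> 'cV[R]_n) -> 'cV[R]_m -> 'cV[R]_n) : Prop :=
  forall H : R, 0 < H -> exists kappa : R -> R,
    [/\ forall s, 0 < s < Delta -> 0 <= kappa s,
        kappa s @[s --> 0^'+] --> 0 &
        forall s x u phi1 phi2, 0 < s < Delta ->
          enorm x <= H -> enorm u <= H ->
          histC Delta phi1 -> histC Delta phi2 ->
          supnorm Delta phi1 <= H -> supnorm Delta phi2 <= H ->
          {in `[- Delta, - s], phi1 =1 phi2} ->
          enorm (fbar x phi1 u - fbar x phi2 u) <=
            kappa s * supnorm Delta (phi1 \- phi2)].

Definition classK (R : realType) (g : R -> R) : Prop :=
  [/\ {within `[0, +oo[, continuous g}, g 0 = 0 &
      forall s t, 0 <= s -> s < t -> g s < g t].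

(* "Decreases" is non-strict, since beta(0, .) = 0 has to be of class L. *)
Definition classL (R : realType) (g : R -> R) : Prop :=
  [/\ {within `[0, +oo[, continuous g},
      forall s t, 0 <= s -> s <= t -> g t <= g s &
      g t @[t --> +oo] --> 0].

Definition classKL (R : realType) (beta : R -> R -> R) : Prop :=
  (forall t, 0 <= t -> classK (fun s => beta s t)) /\
  (forall s, 0 <= s -> classL (beta s)).

Definition truncate (R : realType) (m : nat) (v : R -> 'cV[R]_m) (T1 T2 : R) :
    R -> 'cV[R]_m :=
  fun t => if T1 <= t < T2 then v t else 0.

(* Only applied to functions vanishing on the negative half-line, for which the
   essential suprema over R and over [0, +oo[ coincide. *)
Definition ess_norm (R : realType) (m : nat) (v : R -> 'cV[R]_m) : \bar R :=
  ess_sup (@lebesgue_measure R) (fun t => (enorm (v t))%:E).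

(* The library's [measurable] sets of R are the Borel sets; the domain carries
   here the completed (Lebesgue) sigma-algebra. *)
Definition lebesgue_measurable (R : realType) (m : nat) (v : R -> 'cV[R]_m) :
    Prop :=
  forall i, @measurable_fun _ _
    (g_sigma_algebraType (completed_algebra_gen (@lebesgue_measure R)))
    (measurableTypeR R) `[0, +oo[ (fun t => v t i 0).

Definition input (R : realType) (m : nat) (u : R -> 'cV[R]_m) : Prop :=
  lebesgue_measurable u /\
  (forall T : R, 0 < T -> (ess_norm (truncate u 0 T) < +oo)%E).

Definition absolutely_continuous (R : realType) (n : nat) (a b : R)
    (g : R -> 'cV[R]_n) : Prop :=
  forall e : R, 0 < e -> exists2 delta : R, 0 < delta &
    forall (k : nat) (l r : 'I_k -> R),
      (forall i, a <= l i /\ l i <= r i /\ r i <= b) ->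
      trivIset setT (fun i => `]l i, r i[%classic) ->
      \sum_i (r i - l i) < delta ->
      \sum_i enorm (g (r i) - g (l i)) < e.

(* Solutions on [0, b), where 0 < b <= +oo.  The derivative is two-sided; this
   is harmless at t = 0, a null set. *)
Definition is_solution (R : realType) (n m p : nat) (Delta : R)
    (A : 'I_p -> 'M[R]_n) (d : 'I_p -> R)
    (f : (R -> 'cV[R]_n) -> 'cV[R]_m -> 'cV[R]_n) (u : R -> 'cV[R]_m)
    (xi : R -> 'cV[R]_n) (b : \bar R) (x : R -> 'cV[R]_n) : Prop :=
  [/\ {within [set t | - Delta <= t /\ (t%:E < b)%E], continuous x},
      {in `[- Delta, 0], x =1 xi},
      forall c : R, 0 <= c -> (c%:E < b)%E ->
        absolutely_continuous 0 c (fun t => Dop A d (hist x t)) &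
      {ae (@lebesgue_measure R), forall t, 0 <= t -> (t%:E < b)%E ->
        is_derive t (1 : R) (fun s => Dop A d (hist x s))
          (f (hist x t) (u t))}].

(* "The solution corresponding to xi and u exists for all t >= 0 and satisfies
   P t (x t) for all t >= 0", where the bound is required of every solution, on
   whatever interval [0, b) it is defined. *)
Definition solution_exists_and (R : realType) (n m p : nat) (Delta : R)
    (A : 'I_p -> 'M[R]_n) (d : 'I_p -> R)
    (f : (R -> 'cV[R]_n) -> 'cV[R]_m -> 'cV[R]_n) (u : R -> 'cV[R]_m)
    (xi : R -> 'cV[R]_n) (P : R -> 'cV[R]_n -> Prop) : Prop :=
  (exists x, is_solution Delta A d f u xi +oo x) /\
  (forall b x, (0 < b)%E -> is_solution Delta A d f u xi b x ->
     forall t, 0 <= t -> (t%:E < b)%E -> P t (x t)).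

Definition GES0 (R : realType) (n m p : nat) (Delta : R)
    (A : 'I_p -> 'M[R]_n) (d : 'I_p -> R)
    (f : (R -> 'cV[R]_n) -> 'cV[R]_m -> 'cV[R]_n) : Prop :=
  exists M lambda : R, [/\ 0 < M, 0 < lambda &
    forall xi, histC Delta xi ->
      solution_exists_and Delta A d f (fun=> 0) xi (fun t xt =>
        enorm xt <= M * expR (- lambda * t) * supnorm Delta xi)].

Definition ISS (R : realType) (n m p : nat) (Delta : R)
    (A : 'I_p -> 'M[R]_n) (d : 'I_p -> R)
    (f : (R -> 'cV[R]_n) -> 'cV[R]_m -> 'cV[R]_n) : Prop :=
  exists (beta : R -> R -> R) (gamma : R -> R),
    [/\ classKL beta, classK gamma &
    forall xi u, histC Delta xi -> input u ->
      solution_exists_and Delta A d f u xi (fun t xt =>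
        enorm xt <= beta (supnorm Delta xi) t
                    + gamma (fine (ess_norm (truncate u 0 t))))].

(* Main.v *)
Require Import Defs.
From HB Require Import structures.
From mathcomp Require Import all_boot all_order all_algebra.
From mathcomp Require Import all_classical all_reals all_analysis.
From mathcomp Require Import measurable_realfun ess_sup_inf.
From mathcomp Require Import ring lra.

Set Implicit Arguments.
Unset Strict Implicit.
Unset Printing Implicit Defensive.

Import Order.TTheory GRing.Theory Num.Theory.
Import numFieldNormedType.Exports.

Local Open Scope classical_set_scope.
Local Open Scope ring_scope.

(** The system forgets its initial state over a fixed period, and over a period
    an input displaces a solution by a bounded amount; summing a geometric
    series of displacements gives ISS.

    Let x solve the system with input u and let y solve it with zero input from
    the same initial history; y exists and decays by 0-GES.  The difference
    v = x - y vanishes on [-Delta, 0] and satisfies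
    v(t) = sum_j A_j v(t - d_j) + z(t), where z = D x_t - D y_t is absolutely
    continuous and |z'(s)| <= L0 ||v_s|| + L(|u(s)|) almost everywhere, by the
    two global bounds on f.  If |v(s)| <= S e^(q s) on [-Delta, T], then the
    delayed terms gain a factor e^(-q d_j) and the integration of z' gains a
    factor 1/q, so that for q large enough
      |v(T)| <= (S/2) e^(q T) + |z(0)| + (bound on L(|u|)) T.
    This is [neutral_estimate], and it carries the whole proof.  Taking for S the
    best constant on [0, T] gives S <= S/2 + T sup L(|u|), hence
    |x(t) - y(t)| <= C sup L(|u|) for t in a fixed period [0, T0]
    ([input_comparison]).  When T0 is so large that ||y_T0|| <= ||xi||/2, it
    follows that ||x_T0|| <= ||xi||/2 + C sup L(|u|).  The equation does not
    depend on time, so this can be repeated period after period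
    ([iterated_bound]), and the result is an estimate with
    beta(s, t) = C1 s e^(-q t) and gamma = C2 L ([input_to_state_bound]).

    The bound on z comes from a bound on its derivative almost everywhere.  This
    is a mean value inequality for absolutely continuous functions
    ([ac_mean_value]): an open set of small measure covers the exceptional null
    set, absolute continuity controls the increments over that set, and the
    derivative controls the others.

    A solution for a given input is the limit of successive approximations
    ([picard_solution]).  The input is first replaced by a Borel function equal
    to it almost everywhere and bounded on bounded intervals ([borel_version]),
    so that s |-> f(x_s, u(s)) is measurable for every continuous x
    ([measurable_field]) and has an antiderivative ([antiderivative]).  Linear
    growth of f and [neutral_estimate] keep all the iterates in one ball on
    [-Delta, T]; on that ball f is Lipschitz, and [neutral_estimate] once more,
    with an exponent adapted to that ball, makes the differences of successive
    iterates decrease like 2^-k. *)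

(** * Euclidean and maximum norms *)

Section norms.
Context {R : realType}.

Lemma mxnorm_coord m n (M : 'M[R]_(m, n)) i j : `|M i j| <= `|M|.
Proof.
rewrite [leRHS]/Num.Def.normr/= mx_normrE.
exact: (le_bigmax _ (fun ij => `|M ij.1 ij.2|) (i, j)).
Qed.

Lemma mxnorm_le m n (M : 'M[R]_(m, n)) c : 0 <= c ->
  (forall i j, `|M i j| <= c) -> `|M| <= c.
Proof.
by move=> c0 Mc; rewrite [leLHS]/Num.Def.normr/= mx_normrE bigmax_le// => -[].
Qed.

Lemma mxnorm_mul m n p (M : 'M[R]_(m, n)) (N : 'M[R]_(n, p)) :
  `|M *m N| <= n%:R * `|M| * `|N|.
Proof.
apply: mxnorm_le => [|i j]; first by rewrite !mulr_ge0.
rewrite mxE (le_trans (ler_norm_sum _ _ _))//.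
apply: (@le_trans _ _ (\sum_(k < n) `|M| * `|N|)).
  by apply: ler_sum => k _; rewrite normrM ler_pM// mxnorm_coord.
by rewrite sumr_const card_ord -mulrA mulr_natl.
Qed.

Lemma enorm_ge0 n (v : 'cV[R]_n) : 0 <= enorm v.
Proof. exact: sqrtr_ge0. Qed.

Lemma enorm0 n : enorm (0 : 'cV[R]_n) = 0.
Proof.
by rewrite /enorm big1 ?sqrtr0// => i _; rewrite mxE expr0n.
Qed.

Lemma enormN n (v : 'cV[R]_n) : enorm (- v) = enorm v.
Proof. by congr Num.sqrt; apply: eq_bigr => i _; rewrite mxE sqrrN. Qed.

Lemma mxnorm_le_enorm n (v : 'cV[R]_n) : `|v| <= enorm v.
Proof.
apply: mxnorm_le => [|i j]; first exact: enorm_ge0.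
rewrite (ord1 j) -sqrtr_sqr ler_wsqrtr// (bigD1 i)//= lerDl.
by apply: sumr_ge0 => k _; exact: sqr_ge0.
Qed.

Lemma enorm_le_mxnorm n (v : 'cV[R]_n) : enorm v <= n%:R * `|v|.
Proof.
have -> : n%:R * `|v| = Num.sqrt ((n%:R * `|v|) ^+ 2).
  by rewrite sqrtr_sqr ger0_norm ?mulr_ge0.
rewrite ler_wsqrtr//.
apply: (@le_trans _ _ (\sum_(i < n) `|v| ^+ 2)).
  apply: ler_sum => i _; rewrite -real_normK ?num_real//.
  by rewrite lerXn2r// ?nnegrE// mxnorm_coord.
rewrite sumr_const card_ord -[leLHS]mulr_natl exprMn ler_wpM2r ?sqr_ge0//.
by rewrite -natrX ler_nat; case: n v => // n _; exact: leq_pmulr.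
Qed.

Lemma sqr_enorm n (v : 'cV[R]_n) : enorm v ^+ 2 = \sum_i v i 0 ^+ 2.
Proof. by rewrite sqr_sqrtr// sumr_ge0// => i _; exact: sqr_ge0. Qed.

(** Cauchy-Schwarz, in the form 2 v_i w_i <= (b/a) v_i^2 + (a/b) w_i^2 with
    a = |v| and b = |w|, summed over i. *)
Lemma enormD n (v w : 'cV[R]_n) : enorm (v + w) <= enorm v + enorm w.
Proof.
have enorm_eq0 (x : 'cV[R]_n) : enorm x = 0 -> x = 0.
  by move=> x0; apply/eqP; rewrite -normr_le0 -x0 mxnorm_le_enorm.
have [/enorm_eq0 ->|v0] := eqVneq (enorm v) 0; first by rewrite enorm0 !add0r.
have [/enorm_eq0 ->|w0] := eqVneq (enorm w) 0; first by rewrite enorm0 !addr0.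
have {}v0 : 0 < enorm v by rewrite lt_neqAle eq_sym v0 enorm_ge0.
have {}w0 : 0 < enorm w by rewrite lt_neqAle eq_sym w0 enorm_ge0.
rewrite -ler_sqr ?nnegrE ?addr_ge0 ?enorm_ge0// sqrrD !sqr_enorm.
rewrite (eq_bigr (fun i => v i 0 ^+ 2 + v i 0 * w i 0 *+ 2 + w i 0 ^+ 2)); last first.
  by move=> i _; rewrite mxE sqrrD.
rewrite big_split big_split/= sumrMnl lerD2r lerD2l lerMn2r/=.
set a := enorm v; set b := enorm w.
have -> : a * b = \sum_i (b / a * v i 0 ^+ 2 + a / b * w i 0 ^+ 2) / 2.
  rewrite -mulr_suml big_split/= -!mulr_sumr -!sqr_enorm -/a -/b; field.
  by rewrite !gt_eqF.
apply: ler_sum => i _; rewrite -subr_ge0.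
have -> : (b / a * v i 0 ^+ 2 + a / b * w i 0 ^+ 2) / 2 - v i 0 * w i 0 =
    (b * v i 0 - a * w i 0) ^+ 2 / (2 * a * b) by field; rewrite !gt_eqF.
by rewrite divr_ge0 ?sqr_ge0// !mulr_ge0// ltW.
Qed.

End norms.

(** * A mean value inequality for absolutely continuous functions *)

Section mean_value.
Context {R : realType}.
Notation mu := (@lebesgue_measure R).

(** Continuous induction: [E] spreads from 0 to T as soon as every point s has a
    neighbourhood in which it passes from any point left of s to any point right
    of s.  At the supremum of the points of [E] this hypothesis both reaches the
    supremum and goes beyond it, so neither closedness nor openness of [E] has
    to be established. *)
Lemma interval_induction (T : R) (E : R -> Prop) : 0 <= T -> E 0 ->
  (forall s, 0 <= s <= T -> exists2 eta : R, 0 < eta & forall t t',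
     s - eta < t -> t' < s + eta -> 0 <= t -> t <= s -> s <= t' -> t' <= T ->
     E t -> E t') ->
  E T.
Proof.
move=> T0 E0 step.
pose S := [set t | 0 <= t <= T /\ E t].
have S0 : S 0 by split => //; rewrite lexx.
have hS : has_sup S.
  by split; [exists 0|exists T => t [/andP[_ ?] _]].
have s0T : 0 <= sup S <= T.
  apply/andP; split; first exact: (sup_upper_bound hS).
  by apply: ge_sup; [exists 0|move=> t [/andP[_ ?] _]].
have [eta eta0 h] := step _ s0T.
have [t [/andP[t0 tT] Et] st] := sup_adherent eta0 hS.
have tS : t <= sup S by apply: (sup_upper_bound hS); split => //; apply/andP.
have /andP[S0' ST] := s0T.
pose t' := Num.min T (sup S + eta / 2).
have St' : sup S <= t' by rewrite le_min ST lerDl divr_ge0// ltW.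
have Et' : E t'.
  apply: (h t) => //; last by rewrite ge_min lexx.
  by rewrite gt_min; apply/orP; right; lra.
have : t' <= sup S.
  apply: (sup_upper_bound hS); split => //.
  by rewrite (le_trans S0' St') ge_min lexx.
have [<-//|] : t' = T \/ sup S + eta / 2 <= t'.
  rewrite /t'; case: (leP T (sup S + eta / 2)) => _; [by left|by right].
lra.
Qed.

Lemma is_derive_approx (V : normedModType R) (g : R -> V) (t : R) dg (e : R) :
  is_derive t (1 : R) g dg -> 0 < e ->
  exists2 eta : R, 0 < eta & forall s, `|s - t| < eta ->
    `|g s - g t - (s - t) *: dg| <= e * `|s - t|.
Proof.
move=> [dvg <-] e0.
have := dvg; rewrite /derivable => /cvgrPdist_le /(_ _ e0).
rewrite near_withinE => /nbhs_ballP[eta /= eta0 H].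
exists eta => // s st.
have [->|nst] := eqVneq s t; first by rewrite !subrr scale0r subr0 !normr0 mulr0.
have st0 : s - t != 0 by rewrite subr_eq0.
have := H (s - t); rewrite /ball/= sub0r normrN => /(_ st st0).
rewrite /GRing.scale/= mulr1 subrK => H'.
have -> : g s - g t - (s - t) *: 'D_1 g t =
    - ((s - t) *: ('D_1 g t - (s - t)^-1 *: (g s - g t))).
  by rewrite scalerBr scalerA divff// scale1r opprB.
by rewrite normrN normrZ mulrC ler_wpM2r.
Qed.

Lemma sum_disjoint_itv_le (k : nat) (l r : nat -> R) (U : set R) :
  open U ->
  (forall i, (i < k)%N -> l i <= r i /\ `]l i, r i[ `<=` U) ->
  trivIset setT (fun i : 'I_k => `]l i, r i[%classic) ->
  ((\sum_(i < k) (r i - l i))%:E <= mu U)%E.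
Proof.
move=> oU lr tlr.
have -> : (\sum_(i < k) (r i - l i))%:E = (\sum_(i < k) mu `]l i, r i[)%E.
  rewrite -sumEFin; apply: eq_bigr => i _.
  rewrite lebesgue_measure_itv/= lte_fin; case: ltP => // ril.
  have [lri _] := lr i (ltn_ord i).
  by congr EFin; lra.
rewrite -measure_semi_additive_ord//; last exact: bigsetU_measurable.
apply: le_measure; rewrite ?inE.
- exact: bigsetU_measurable.
- exact: open_measurable.
- by elim/big_ind: _ => [//|A B AU BU x [/AU|/BU]//|i _]; have [] := lr i (ltn_ord i).
Qed.

(** Cover the null set on which the derivative bound fails by an open set U of
    measure less than delta, and follow g from 0 to T.  Near a point outside U
    the increments of g are bounded by those of phi, up to an error
    proportional to the length; near a point of U the step is recorded as an
    interval contained in U.  The recorded intervals are disjoint and have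
    total length less than delta, hence by absolute continuity they contribute
    less than a prescribed amount. *)
Lemma ac_mean_value n (g : R -> 'cV[R]_n) (phi dphi : R -> R) (T : R) :
  0 <= T -> absolutely_continuous 0 T g ->
  (forall s t, s <= t -> phi s <= phi t) ->
  (forall t, 0 <= t <= T -> is_derive t (1 : R) phi (dphi t)) ->
  {ae mu, forall t : R, 0 <= t -> t < T ->
     exists2 dg, is_derive t (1 : R) g dg & `|dg| <= dphi t} ->
  `|g T - g 0| <= phi T - phi 0.
Proof.
move=> T0 acg phiM dphiP [N [mN N0 subN]].
apply/ler_addgt0Pr => e e0.
have T1 : 0 < 2 * (T + 1) by lra.
pose e1 := e / (2 * (T + 1)).
have e10 : 0 < e1 by exact: divr_gt0.
have e1T : e1 * T <= e / 2.
  have -> : e1 * T = e / 2 * (T / (T + 1)) by rewrite /e1; field; lra.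
  by apply: ler_piMr; [lra|rewrite ler_pdivrMr ?mul1r; lra].
have [delta delta0 acd] := acg _ (divr_gt0 e0 (ltr0n _ 2)).
(* Nothing is known about a derivative at T, so T is treated as exceptional. *)
pose D := N `|` [set T].
have mD : measurable D by exact: measurableU.
have D0 : mu D = 0%E.
  by rewrite measureU0 //; exact: lebesgue_measure_set1.
have Dfin : (mu D < +oo)%E by rewrite D0 ltry.
have [U [oU DU Udelta]] := lebesgue_regularity_outer mD Dfin delta0.
have mU : measurable U by exact: open_measurable.
have {}Udelta : (mu U < delta%:E)%E.
  apply: le_lt_trans Udelta.
  by rewrite [leLHS](measureDI mu mU mD) (setIidr DU) [X in (_ + X <= _)%E]D0 adde0.
(* The k recorded intervals lie in U, are listed from left to right and
   end at t or before. *)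
pose E t := exists (k : nat) (l r : nat -> R),
  [/\ forall i, (i < k)%N -> [/\ 0 <= l i, l i <= r i, r i <= t &
        `]l i, r i[ `<=` U],
      forall i j, (i < j < k)%N -> r i <= l j &
      `|g t - g 0| <= phi t - phi 0 + e1 * t +
        \sum_(i < k) `|g (r i) - g (l i)|].
suff : E T.
  move=> [k [l [r [lrU lr gT]]]].
  rewrite (le_trans gT)// -addrA lerD2l.
  suff : \sum_(i < k) `|g (r i) - g (l i)| < e / 2 by lra.
  have tlr : trivIset setT (fun i : 'I_k => `]l i, r i[%classic).
    apply/trivIsetP => i j _ _; wlog ij : i j / (i < j)%N => [H ij|_].
      move: (ij); rewrite neq_ltn => /orP[/H->//|ji].
      by rewrite setIC H// eq_sym.
    have rilj : r i <= l j by apply: lr; rewrite ij /=.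
    apply/seteqP; split => // x/=; rewrite !in_itv/= => -[/andP[_ xr] /andP[lx _]].
    by have := lt_trans lx xr; rewrite ltNge rilj.
  apply: le_lt_trans (acd k (fun i => l i) (fun i => r i) _ tlr _).
  - by apply: ler_sum => i _; exact: mxnorm_le_enorm.
  - by move=> i; have [] := lrU i (ltn_ord i).
  - rewrite -lte_fin (le_lt_trans _ Udelta)//.
    by apply: sum_disjoint_itv_le => // i /lrU[].
apply: (interval_induction T0).
  exists 0%N, (fun=> 0), (fun=> 0); split => //.
  by rewrite !subrr normr0 mulr0 big_ord0 !addr0.
move=> s /andP[s0 sT].
have [Us|Us] := pselect (U s).
  have /nbhs_ballP[eta /= eta0 sU] := open_nbhs_nbhs (conj oU Us).
  exists eta => // t t' st t's t0 ts st' t'T [k [l [r [lrU lr gt]]]].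
  exists k.+1, (fun i => if i == k then t else l i),
    (fun i => if i == k then t' else r i); split.
  - move=> i; rewrite ltnS leq_eqVlt; case: eqP => /= [_ _|_ /lrU[? ? rit ?]].
      split; [by []|lra|by []|].
      move=> x/=; rewrite in_itv/= => /andP[tx xt']; apply: sU.
      by rewrite /ball/= ltr_norml; lra.
    by split => //; lra.
  - move=> i j /andP[ij]; rewrite ltnS leq_eqVlt.
    have [jk _|_ /= jk] := eqVneq j k.
      have ik : (i < k)%N by rewrite -jk.
      by rewrite (ltn_eqF ik); have [] := lrU _ ik.
    by rewrite (ltn_eqF (ltn_trans ij jk)); apply: lr; rewrite ij.
  - rewrite big_ord_recr/= eqxx.
    under eq_bigr => i _ do rewrite (ltn_eqF (ltn_ord i)).
    have tt' : t <= t' by lra.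
    have := phiM _ _ tt'; have : e1 * t <= e1 * t' by rewrite ler_wpM2l// ltW.
    have := ler_normD (g t' - g t) (g t - g 0); rewrite subrKA; lra.
have nD : ~ D s by move=> /DU.
have sltT : s < T.
  by rewrite lt_neqAle sT andbT; apply/eqP => sT'; apply: nD; right.
have [dg gs dgs] : exists2 dg, is_derive s (1:R) g dg & `|dg| <= dphi s.
  apply: contrapT => H; apply: nD; left; apply: subN => /= H'.
  by apply: H; exact: H'.
have e120 : 0 < e1 / 2 by rewrite divr_gt0.
have [eta1 eta10 h1] := is_derive_approx gs e120.
have [eta2 eta20 h2] := is_derive_approx (dphiP s (introT andP (conj s0 sT))) e120.
exists (Num.min eta1 eta2); first by rewrite lt_min eta10.
move=> t t' st t's t0 ts st' t'T [k [l [r [lrU lr gt]]]].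
exists k, l, r; split => //.
  by move=> i /lrU[? ? rit ?]; split => //; lra.
have m1 : Num.min eta1 eta2 <= eta1 by rewrite ge_min lexx.
have m2 : Num.min eta1 eta2 <= eta2 by rewrite ge_min lexx orbT.
have g1 : `|g t' - g t| <= (dphi s + e1 / 2) * (t' - t).
  have := h1 t; have := h1 t'.
  rewrite (ger0_norm (_ : 0 <= t' - s)) ?subr_ge0//.
  rewrite (ler0_norm (_ : t - s <= 0)) ?subr_le0//.
  set a := g t' - _ - _; set b := g t - _ - _ => ha hb.
  have -> : g t' - g t = a - b + (t' - t) *: dg.
    by apply/matrixP => i j; rewrite !mxE; ring.
  rewrite (le_trans (ler_normD _ _))// (le_trans (lerD (ler_normB _ _) (lexx _)))//.
  rewrite normrZ (ger0_norm (_ : 0 <= t' - t)); last lra.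
  have := ler_wpM2l (_ : 0 <= t' - t) dgs; rewrite subr_ge0 => /(_ (le_trans ts st')).
  have := ha ltac:(lra); have := hb ltac:(lra).
  move: (`|a|) (`|b|) (`|dg|) => x y z; lra.
have p1 : (dphi s - e1 / 2) * (t' - t) <= phi t' - phi t.
  have := h2 t; have := h2 t'.
  rewrite (ger0_norm (_ : 0 <= t' - s)) ?subr_ge0//.
  rewrite (ler0_norm (_ : t - s <= 0)) ?subr_le0//.
  move=> /(_ ltac:(lra)) /ler_normlP[+ +] /(_ ltac:(lra)) /ler_normlP[].
  by rewrite /GRing.scale/= => *; lra.
have := ler_normD (g t' - g t) (g t - g 0); rewrite subrKA => /le_trans.
apply; apply: le_trans (lerD g1 gt) _; lra.
Qed.

End mean_value.

(** * The basic estimate for the neutral equation *)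

Section neutral_estimate.
Context {R : realType}.
Notation mu := (@lebesgue_measure R).

Lemma absolutely_continuousB n (a b : R) (g1 g2 : R -> 'cV[R]_n) :
  absolutely_continuous a b g1 -> absolutely_continuous a b g2 ->
  absolutely_continuous a b (fun t => g1 t - g2 t).
Proof.
move=> ac1 ac2 e e0; have e2 : 0 < e / 2 by rewrite divr_gt0.
have [d1 d10 H1] := ac1 _ e2; have [d2 d20 H2] := ac2 _ e2.
exists (Num.min d1 d2); first by rewrite lt_min d10.
move=> k l r lr tlr; rewrite lt_min => /andP[s1 s2].
rewrite [e]splitr.
apply: le_lt_trans (ltrD (H1 k l r lr tlr s1) (H2 k l r lr tlr s2)).
rewrite -big_split/=; apply: ler_sum => i _.
rewrite -(enormN (g2 (r i) - g2 (l i))); apply: le_trans (enormD _ _).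
rewrite (_ : g1 (r i) - g2 (r i) - _ = g1 (r i) - g1 (l i) - (g2 (r i) - g2 (l i)))//.
by apply/matrixP => a' b'; rewrite !mxE; ring.
Qed.

(** Bounds the operator norm of (y_j) |-> sum_j A_j y_j for maximum norms. *)
Definition delay_gain n p (A : 'I_p -> 'M[R]_n) : R := \sum_j n%:R * `|A j|.

Lemma delay_gain_ge0 n p (A : 'I_p -> 'M[R]_n) : 0 <= delay_gain A.
Proof. by apply: sumr_ge0 => j _; rewrite mulr_ge0. Qed.

(** One application of y |-> sum_j A_j y(. - d_j) + z in the weighted norm
    sup |y(s)| e^(-m s).  A delay d_j >= h brings the factor
    e^(-m d_j) <= 1/(m h), and integrating the bound K S e^(m s) on z' gives
    (K/m) S e^(m T); the condition on m makes the two factors add up to at most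
    1/2.  In the comparison of two solutions v and w are the same difference; in
    the successive approximations they are consecutive iterates, or consecutive
    differences of iterates. *)
Lemma neutral_estimate n p (A : 'I_p -> 'M[R]_n) (d : 'I_p -> R)
    (Delta h K m S c T : R) (v z : R -> 'cV[R]_n) (w : 'cV[R]_n) :
  0 < h -> (forall j, h <= d j <= Delta) ->
  0 <= K -> 0 < m -> delay_gain A / h + K <= m / 2 ->
  0 <= S -> 0 <= c -> 0 <= T ->
  (forall s, - Delta <= s -> s <= T -> `|v s| <= S * expR (m * s)) ->
  w = \sum_j A j *m v (T - d j) + z T ->
  absolutely_continuous 0 T z ->
  {ae mu, forall t : R, 0 <= t -> t < T ->
     exists2 dz, is_derive t (1 : R) z dz & `|dz| <= K * (S * expR (m * t)) + c} ->
  `|w| <= S / 2 * expR (m * T) + `|z 0| + c * T.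
Proof.
move=> h0 hd K0 m0 hm S0 c0 T0 vS -> acz dz.
have E0 : 0 <= S * expR (m * T) by rewrite mulr_ge0// expR_ge0.
have h1 : `|\sum_j A j *m v (T - d j)| <= delay_gain A / h / m * (S * expR (m * T)).
  rewrite (le_trans (ler_norm_sum _ _ _))// /delay_gain !mulr_suml ler_sum// => j _.
  have /andP[hdj djD] := hd j.
  rewrite (le_trans (mxnorm_mul _ _))// -!mulrA ler_wpM2l// ler_wpM2l//.
  rewrite (le_trans (vS _ _ _))//; [lra|lra|].
  rewrite mulrBr expRD expRN.
  have mh : 0 < h * m by rewrite mulr_gt0.
  have -> : h^-1 * (m^-1 * (S * expR (m * T))) = (h * m)^-1 * (S * expR (m * T)).
    by rewrite invfM mulrA.
  rewrite mulrA mulrC ler_wpM2r//.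
  rewrite lef_pV2 ?posrE ?expR_gt0// (le_trans _ (expR_ge1Dx _))//.
  by have := ler_wpM2l (ltW m0) hdj; lra.
(* The antiderivative of the bound on z'. *)
pose phi t := K * S / m * expR (m * t) + c * t.
pose dphi t := K * (S * expR (m * t)) + c.
have h5 : 0 <= K * S / m by rewrite divr_ge0 ?mulr_ge0// ltW.
have phiM s t : s <= t -> phi s <= phi t.
  move=> st; apply: lerD; rewrite ler_wpM2l// ler_expR.
  by rewrite ler_wpM2l// ltW.
have dphiP t : 0 <= t <= T -> is_derive t (1 : R) phi (dphi t).
  move=> _; rewrite /phi /dphi.
  apply: is_derive_eq; rewrite /GRing.scale/= ; field.
  by lra.
have := ac_mean_value T0 acz phiM dphiP dz.
rewrite /phi !mulr0 addr0 expR0 => h2.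
rewrite (le_trans (ler_normD _ _))//.
have h3 : `|z T| <= `|z T - z 0| + `|z 0|.
  by rewrite -{1}(subrK (z 0) (z T)) ler_normD.
have h4 : (delay_gain A / h / m + K / m) * (S * expR (m * T)) <=
    2^-1 * (S * expR (m * T)).
  rewrite ler_wpM2r// -mulrDl ler_pdivrMr//; lra.
have h6 : K * S / m * expR (m * T) = K / m * (S * expR (m * T)) by ring.
lra.
Qed.

End neutral_estimate.

(** * Antiderivatives of locally bounded measurable functions *)

Section antiderivative.
Context {R : realType}.
Notation mu := (@lebesgue_measure R).

(** Lets [filterS] and its variants combine almost-everywhere statements. *)
#[global] Instance ae_lebesgue_filter : Filter (nbhs (almost_everywhere mu)) :=
  ae_filter_ringOfSetsType mu.

Lemma ae_neq (a : R) : {ae mu, forall t : R, t <> a}.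
Proof.
exists [set a]; split => //; first exact: lebesgue_measure_set1.
by move=> t /= /contrapT.
Qed.

Lemma bounded_integrable_itv (g : R -> R) (K : set R) (T C : R) :
  measurable_fun setT g -> measurable K -> (forall t, K t -> `|t| <= T) ->
  (forall t, `|t| <= T -> `|g t| <= C) -> mu.-integrable K (EFin \o g).
Proof.
move=> mg mK KT gC; apply: measurable_bounded_integrable => //.
- apply: (@le_lt_trans _ _ (mu `[- T, T])).
    apply: le_measure; rewrite ?inE//.
    by move=> t /KT; rewrite ler_norml/= in_itv.
  by rewrite lebesgue_measure_itv/=; case: ifP => // _; rewrite ltry.
- exact: measurable_funS mg.
- exists C; split; first exact: num_real.
  by move=> x Cx t /KT /gC /= h; rewrite (le_trans h)// ltW.
Qed.

Lemma antiderivative_scalar (g : R -> R) : measurable_fun setT g ->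
  (forall T, exists C, forall t, `|t| <= T -> `|g t| <= C) ->
  exists F : R -> R, [/\ F 0 = 0,
    forall T C s t, (forall r, `|r| <= T -> `|g r| <= C) ->
      0 <= s -> s <= t -> t <= T -> `|F t - F s| <= C * (t - s) &
    {ae mu, forall t : R, 0 <= t -> is_derive t (1 : R) F (g t)}].
Proof.
move=> mg bg.
have ig y : mu.-integrable `[0, y] (EFin \o g).
  have [C gC] := bg y; apply: (@bounded_integrable_itv _ _ y C) => // t.
  by rewrite /= in_itv/= => /andP[t0 ty]; rewrite ger0_norm.
have lg : locally_integrable setT g.
  split => //; first exact: openT.
  move=> K _ cK; have [M [_ KM]] := compact_bounded cK.
  have [C gC] := bg (M + 1).
  suff /integrableP[] : mu.-integrable K (EFin \o g) by [].
  apply: (@bounded_integrable_itv _ _ (M + 1) C) => //; first exact: compact_measurable.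
  by move=> t Kt; apply: KM => //; rewrite ltrDl.
exists (fun x => \int[mu]_(t in `[0, x]) g t)%R; split.
- by rewrite set_itv1 Rintegral_set1.
- move=> T C s t gC s0 st tT.
  rewrite Rintegral_itvB//= ?bnd_simp//.
  have i1 : mu.-integrable `]s, t] (EFin \o g).
    apply: integrableS (ig t) => //.
    by move=> x /=; rewrite !in_itv/= => /andP[sx ->];
      rewrite andbT ltW// (le_lt_trans s0).
  have mst : fine (mu `]s, t]) = t - s.
    rewrite lebesgue_measure_itv/= lte_fin; case: ltP => //= ts; lra.
  apply: le_trans (le_normr_Rintegral _ i1) _ => //.
  rewrite -mst -Rintegral_cst//; apply: le_Rintegral => //.
  + exact: integrable_norm i1.
  + apply: (@bounded_integrable_itv _ _ T `|C|) => //.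
    by move=> x/=; rewrite in_itv/= => /andP[sx xt]; rewrite ger0_norm; lra.
  + move=> x; rewrite /= in_itv/= => /andP[sx xt]; apply: gC.
    by rewrite ger0_norm; lra.
- have := @FTC1 R g (BLeft 0) ig lg; apply: filterS2 (ae_neq 0) => t tneq0 Ht t0.
  have [|dF F'] := Ht; first by rewrite lte_fin lt_neqAle t0 eq_sym (introN eqP).
  by apply: DeriveDef; [exact: dF|rewrite -derive1E; exact: F'].
Qed.

(** The antiderivative of a locally bounded function is locally Lipschitz, which
    gives both its continuity and its absolute continuity. *)
Lemma antiderivative n (g : R -> 'cV[R]_n) :
  (forall i, measurable_fun setT (fun t => g t i 0)) ->
  (forall T, exists C, forall t, `|t| <= T -> `|g t| <= C) ->
  exists F : R -> 'cV[R]_n, [/\ F 0 = 0,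
    forall T, exists2 C, 0 <= C & forall s t, 0 <= s -> s <= T -> 0 <= t -> t <= T ->
      `|F t - F s| <= C * `|t - s| &
    {ae mu, forall t : R, 0 <= t -> is_derive t (1 : R) F (g t)}].
Proof.
move=> mg bg.
have bgi i T : exists C, forall t, `|t| <= T -> `|g t i 0| <= C.
  have [C gC] := bg T; exists C => t /gC; exact/le_trans/mxnorm_coord.
pose F i := sval (cid (antiderivative_scalar (mg i) (bgi i))).
have FP i := svalP (cid (antiderivative_scalar (mg i) (bgi i))).
exists (fun t => \col_i F i t); split.
- by apply/matrixP => i j; rewrite !mxE; have [] := FP i.
- move=> T; have [C gC] := bg T; exists `|C| => // s t.
  wlog st : s t / s <= t.
    move=> H s0 sT t0 tT; have [st|/ltW ts] := leP s t; first exact: H.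
    by rewrite distrC (distrC t) H.
  move=> s0 sT t0 tT; apply: mxnorm_le => [|i j]; first by rewrite mulr_ge0.
  rewrite !mxE (ger0_norm (_ : 0 <= t - s)) ?subr_ge0//.
  have [_ H _] := FP i; apply: H tT => // r /gC h.
  by rewrite (le_trans (mxnorm_coord _ _ _))// (le_trans h)// ler_norm.
- have : {ae mu, forall t : R, forall i, 0 <= t -> is_derive t (1 : R) (F i) (g t i 0)}.
    by apply: filter_forall => i; have [] := FP i.
  apply: filterS => t Ht t0.
  have dF : derivable (fun t => \col_i F i t) t 1.
    apply/derivable_mxP => i j; under eq_fun do rewrite mxE.
    by have [] := Ht i t0.
  split => //; rewrite derive_mx//; apply/matrixP => i j; rewrite mxE (ord1 j).
  under eq_fun do rewrite mxE.
  by have [] := Ht i t0.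
Qed.

Lemma lipschitz_absolutely_continuous n (F : R -> 'cV[R]_n) (T C : R) :
  (forall s t, 0 <= s -> s <= T -> 0 <= t -> t <= T ->
      `|F t - F s| <= C * `|t - s|) ->
  absolutely_continuous 0 T F.
Proof.
move=> lF e e0; pose C' := n%:R * `|C| + 1.
have C'0 : 0 < C' by rewrite ltr_wpDl// mulr_ge0.
exists (e / C'); first exact: divr_gt0.
move=> k l r lr _; rewrite ltr_pdivlMr// mulrC; apply: le_lt_trans.
rewrite mulr_sumr; apply: ler_sum => i _; have [? [? ?]] := lr i.
rewrite (le_trans (enorm_le_mxnorm _))//.
have := lF (l i) (r i) ltac:(lra) ltac:(lra) ltac:(lra) ltac:(lra).
rewrite ger0_norm ?subr_ge0// => h.
apply: (@le_trans _ _ (n%:R * (`|C| * (r i - l i)))).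
  by rewrite ler_wpM2l// (le_trans h)// ler_wpM2r ?subr_ge0// ler_norm.
by rewrite mulrA ler_wpM2r ?subr_ge0// /C' lerDl.
Qed.

End antiderivative.

(** * Histories and their supremum norms *)

Section histories.
Context {R : realType}.

Lemma within_continuousP (V : normedModType R) (B : set R) (f : R -> V) :
  {within B, continuous f} <-> forall s, B s -> forall e : R, 0 < e ->
    exists2 eta : R, 0 < eta & forall t, B t -> `|t - s| < eta -> `|f t - f s| <= e.
Proof.
rewrite subspace_continuousP; split=> H s Bs.
  move=> e e0; have /cvgrPdist_le /(_ e e0) := H s Bs.
  rewrite near_withinE => /nbhs_ballP[eta /= eta0 h].
  by exists eta => // t Bt ts; rewrite distrC; apply: h => //; rewrite /ball/= distrC.
apply/cvgrPdist_le => e e0; have [eta eta0 h] := H s Bs e e0.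
rewrite near_withinE; apply/nbhs_ballP; exists eta => //= t.
by rewrite /ball/= distrC => ts Bt; rewrite distrC; exact: h.
Qed.

Lemma within_continuous_shift (V : normedModType R) (B B' : set R) (x : R -> V) t :
  {within B, continuous x} -> (forall s, B' s -> B (t + s)) ->
  {within B', continuous (fun s => x (t + s))}.
Proof.
move=> /within_continuousP cx BB'; apply/within_continuousP => s Bs e e0.
have [eta eta0 h] := cx _ (BB' _ Bs) e e0; exists eta => // s' Bs' ss'.
apply: h; first exact: BB'.
by rewrite opprD addrACA subrr add0r.
Qed.

Lemma supnorm_ge n (r : R) (phi : R -> 'cV[R]_n) (tau : R) :
  histC r phi -> - r <= tau <= 0 -> enorm (phi tau) <= supnorm r phi.
Proof.
move=> cphi /andP[rt t0]; apply: ub_le_sup;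
  last by exists tau => //; rewrite /= in_itv/= rt.
have : {within `[- r, 0], continuous (fun t => `|phi t|)}.
  by move=> t; apply: (continuous_comp (cphi t)); exact: norm_continuous.
move=> /(EVT_max (le_trans rt t0))[c _ hc].
exists (n%:R * `|phi c|) => _ [s rs <-]; apply: le_trans (enorm_le_mxnorm _) _.
by rewrite ler_wpM2l// hc.
Qed.

Lemma supnorm_le n (r B : R) (phi : R -> 'cV[R]_n) : 0 <= r ->
  (forall tau, - r <= tau <= 0 -> enorm (phi tau) <= B) -> supnorm r phi <= B.
Proof.
move=> r0 phiB; apply: ge_sup.
  by exists (enorm (phi 0)), 0 => //; rewrite /= in_itv/= lexx oppr_le0 r0.
by move=> _ [tau + <-]; rewrite /= in_itv/=; exact: phiB.
Qed.

Lemma supnorm_ge0 n (r : R) (phi : R -> 'cV[R]_n) :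
  0 <= r -> histC r phi -> 0 <= supnorm r phi.
Proof.
move=> r0 cphi; apply: le_trans (supnorm_ge cphi (_ : - r <= 0 <= 0)).
  exact: enorm_ge0.
by rewrite oppr_le0 r0 lexx.
Qed.

Lemma supnorm_le_mxnorm n (r B : R) (phi : R -> 'cV[R]_n) : 0 <= r ->
  (forall tau, - r <= tau <= 0 -> `|phi tau| <= B) -> supnorm r phi <= n%:R * B.
Proof.
move=> r0 phiB; apply: supnorm_le => // tau /phiB h.
by rewrite (le_trans (enorm_le_mxnorm _))// ler_wpM2l.
Qed.

(** The least admissible S is the maximum of |v(t)| e^(-m t), which continuity
    makes attained. *)
Lemma exponential_envelope n (v : R -> 'cV[R]_n) (m T : R) : 0 <= T ->
  {within `[0, T], continuous v} ->
  exists2 S : R, 0 <= S & (exists2 t, 0 <= t <= T & `|v t| = S * expR (m * t)) /\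
    forall t, 0 <= t <= T -> `|v t| <= S * expR (m * t).
Proof.
move=> T0 cv.
have : {within `[0, T], continuous
    ((fun t => `|v t|) \* (fun t => expR (- (m * t))))}.
  move=> t; apply: continuousM.
    by apply: (continuous_comp (cv t)); exact: norm_continuous.
  apply: continuous_subspaceT => s.
  by apply: differentiable_continuous; apply/derivable1_diffP; apply: ex_derive.
move=> /(EVT_max T0)[c + hc]; rewrite in_itv/= => c0T.
have e t (a : R) : a = a * expR (- (m * t)) * expR (m * t).
  by rewrite -mulrA -expRD addNr expR0 mulr1.
exists (`|v c| * expR (- (m * c))); first by rewrite mulr_ge0// expR_ge0.
split; first by exists c => //; exact: e.
by move=> t t0T; rewrite {1}(e t `|v t|) ler_wpM2r ?expR_ge0// hc// in_itv.
Qed.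

End histories.

(** * Displacement of a solution by the input *)

Section comparison.
Context {R : realType} {n m p : nat}.
Notation mu := (@lebesgue_measure R).

Lemma min_delay (d : 'I_p -> R) : (forall j, 0 < d j) ->
  exists2 h : R, 0 < h & forall j, h <= d j.
Proof.
move=> d0; exists (\big[Order.min/1]_j d j).
  by elim/big_ind: _ => // x y x0 y0; rewrite lt_min x0.
by move=> j; apply: bigmin_le.
Qed.

(** The exponent with which [neutral_estimate] gains a factor 1/2. *)
Lemma rate_exists (a h K : R) : 0 < h -> 0 <= a -> 0 <= K ->
  exists2 q : R, 0 < q & a / h + K <= q / 2.
Proof.
move=> h0 a0 K0; have ah : 0 <= a / h by rewrite divr_ge0// ltW.
by exists (2 * (a / h + K) + 1); lra.
Qed.

(** The difference v of the two solutions satisfies the neutral equation with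
    v = 0 on [-Delta, 0].  Let S be the least constant of an exponential bound
    of v; at the point where it is attained, [neutral_estimate] gives
    S <= S/2 + T0 l. *)
Lemma input_comparison (Delta : R) (d : 'I_p -> R) (A : 'I_p -> 'M[R]_n)
    (f : (R -> 'cV[R]_n) -> 'cV[R]_m -> 'cV[R]_n) (L0 : R) (L : R -> R) (T0 : R) :
  0 < Delta -> (forall j, 0 < d j <= Delta) -> 0 <= L0 ->
  (forall phi1 phi2 u, histC Delta phi1 -> histC Delta phi2 ->
     enorm (f phi1 u - f phi2 0) <= L0 * supnorm Delta (phi1 \- phi2) + L (enorm u)) ->
  0 <= T0 ->
  exists2 C : R, 0 <= C & forall u xi b x y l t,
    is_solution Delta A d f u xi b x -> is_solution Delta A d f (fun=> 0) xi +oo y ->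
    0 <= l -> 0 <= t -> t <= T0 -> (t%:E < b)%E ->
    {ae mu, forall s : R, 0 <= s -> s < t -> L (enorm (u s)) <= l} ->
    enorm (x t - y t) <= C * l.
Proof.
move=> Delta0 dD L00 fL T00.
have [h h0 hd] := min_delay (fun j => (andP (dD j)).1).
have hdD j : h <= d j <= Delta by rewrite hd/=; have /andP[] := dD j.
pose K := L0 * n%:R; have K0 : 0 <= K by rewrite mulr_ge0.
have [q q0 hq] := rate_exists h0 (delay_gain_ge0 A) K0.
exists (n%:R * (2 * T0 * expR (q * T0))); first by rewrite !mulr_ge0// expR_ge0.
move=> u xi b x y l t [cx xxi acx dx] [cy yxi acy dy] l0 t0 tT0 tb uL.
pose v s := x s - y s.
have xy0 s : - Delta <= s <= 0 -> v s = 0.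
  by move=> Ds; rewrite /v xxi ?yxi ?subrr// in_itv.
have cv : {within `[0, t], continuous v}.
  move=> s; apply: continuousB.
    apply: (continuous_subspaceW _ cx) => r/=; rewrite in_itv/= => /andP[r0 rt].
    split; first by lra.
    by apply: le_lt_trans tb; rewrite lee_fin.
  apply: (continuous_subspaceW _ cy) => r/=; rewrite in_itv/= => /andP[r0 rt].
  split; first by lra.
  exact: ltry.
have [S S0 [[c /andP[c0 ct] vc] vS]] := exponential_envelope q t0 cv.
have cb : (c%:E < b)%E by apply: le_lt_trans tb; rewrite lee_fin.
have vS' s : - Delta <= s -> s <= t -> `|v s| <= S * expR (q * s).
  move=> Ds st; have [s0|/ltW s0] := leP 0 s; first by apply: vS; rewrite s0.
  by rewrite xy0 ?normr0 ?mulr_ge0 ?expR_ge0// Ds.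
pose z s := Dop A d (hist x s) - Dop A d (hist y s).
have z0 : z 0 = 0.
  rewrite /z /Dop /hist !add0r xxi ?in_itv/= ?lexx ?oppr_le0 ?ltW//.
  rewrite yxi ?in_itv/= ?lexx ?oppr_le0 ?ltW//.
  apply/eqP; rewrite subr_eq0; apply/eqP; congr (_ - _); apply: eq_bigr => j _.
  by have /andP[dj djD] := dD j;
    rewrite !add0r xxi ?yxi// in_itv/= lerN2 djD oppr_le0 ltW.
have acz : absolutely_continuous 0 c z.
  by apply: absolutely_continuousB; [exact: acx|apply: acy => //; exact: ltry].
have vcE : v c = \sum_j A j *m v (c - d j) + z c.
  rewrite /z /Dop /hist /v !addr0.
  under eq_bigr => j _ do rewrite mulmxBr.
  rewrite sumrB; apply/matrixP => i j; rewrite !mxE; ring.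
have zd : {ae mu, forall s : R, 0 <= s -> s < c ->
     exists2 dz, is_derive s (1 : R) z dz & `|dz| <= K * (S * expR (q * s)) + l}.
  apply: filterS3 dx dy uL => s xs ys us s0 sc.
  have sb : (s%:E < b)%E by apply: lt_trans cb; rewrite lte_fin.
  exists (f (hist x s) (u s) - f (hist y s) 0).
    by have dxs := xs s0 sb; have dys := ys s0 (ltry _); apply: is_deriveB.
  have hx : histC Delta (hist x s).
    apply: (within_continuous_shift cx) => r/=; rewrite in_itv/= => /andP[r0 rt].
    split; first by lra.
    by apply: le_lt_trans sb; rewrite lee_fin; lra.
  have hy : histC Delta (hist y s).
    apply: (within_continuous_shift cy) => r/=; rewrite in_itv/= => /andP[r0 rt].
    split; first by lra.
    exact: ltry.
  rewrite (le_trans (mxnorm_le_enorm _))// (le_trans (fL _ _ _ hx hy))// lerD//.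
    rewrite /K -mulrA ler_wpM2l//; apply: supnorm_le_mxnorm; first exact: ltW.
    move=> tau /andP[Dt tau0].
    have st1 : - Delta <= s + tau by lra.
    have st2 : s + tau <= t by lra.
    have -> : (hist x s \- hist y s) tau = v (s + tau) by [].
    apply: le_trans (vS' _ st1 st2) _.
    by rewrite ler_wpM2l// ler_expR (ler_wpM2l (ltW q0))//; lra.
  by apply: us => //; exact: lt_le_trans ct.
have vS'' s : - Delta <= s -> s <= c -> `|v s| <= S * expR (q * s).
  by move=> Ds sc; apply: vS' => //; exact: le_trans ct.
have := neutral_estimate h0 hdD K0 q0 hq S0 l0 c0 vS'' vcE acz zd.
rewrite z0 normr0 addr0 vc => hS.
(* [hS] reads S e^(q c) <= S/2 e^(q c) + l c. *)
have S2 : S <= 2 * T0 * l.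
  have e1 : 1 <= expR (q * c) by rewrite -expR0 ler_expR mulr_ge0// ltW.
  have h1 : S / 2 <= S / 2 * expR (q * c) by rewrite ler_peMr// divr_ge0.
  have h2 : l * c <= l * T0 by rewrite ler_wpM2l//; lra.
  lra.
apply: le_trans (enorm_le_mxnorm _) _; rewrite -mulrA ler_wpM2l//.
apply: (le_trans (vS t _)); first by rewrite t0 lexx.
rewrite [leRHS](_ : _ = 2 * T0 * l * expR (q * T0)); last by ring.
by rewrite ler_pM ?expR_ge0// ler_expR (ler_wpM2l (ltW q0)).
Qed.

End comparison.

(** * Translation in time *)

Section translation.
Context {R : realType}.
Notation mu := (@lebesgue_measure R).

Definition translation (a : R) : measurableTypeR R -> measurableTypeR R :=
  fun t => a + t.

Lemma measurable_translation (a : R) : measurable_fun setT (translation a).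
Proof. by apply: measurable_funD => //; exact: measurable_cst. Qed.

HB.instance Definition _ (a : R) :=
  isMeasurableFun.Build _ _ _ _ (translation a) (measurable_translation a).

(** Both sides are measures that agree on half-open intervals. *)
Lemma lebesgue_measure_translation (a : R) (B : set R) : measurable B ->
  mu (translation a @^-1` B) = mu B.
Proof.
move=> mB; rewrite -[LHS]/(pushforward mu (translation a) B).
apply/esym/lebesgue_measure_unique => //= _ [[x y]] _ <-.
rewrite /pushforward (_ : _ @^-1` _ = `]x - a, y - a]%classic).
  rewrite !lebesgue_measure_itv/= !lte_fin ltrD2r.
  by case: ifP => // _; congr EFin; ring.
by apply/seteqP; split => t; rewrite /translation/= !in_itv/= => /andP[xt ty];
  apply/andP; split; lra.
Qed.

Lemma ae_translation (a : R) (P : R -> Prop) :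
  {ae mu, forall t : R, P t} -> {ae mu, forall t : R, P (a + t)}.
Proof.
move=> [N [mN N0 PN]]; exists (translation a @^-1` N); split.
- by rewrite -[X in measurable X]setTI; exact: measurable_translation.
- by rewrite lebesgue_measure_translation.
- by move=> t /= Pt; apply: PN.
Qed.

Lemma absolutely_continuous_translation n (a c : R) (g : R -> 'cV[R]_n) :
  0 <= a -> absolutely_continuous 0 (a + c) g ->
  absolutely_continuous 0 c (fun t => g (a + t)).
Proof.
move=> a0 acg e /acg[delta delta0 H]; exists delta => // k l r lr tlr s.
apply: (H k (fun i => a + l i) (fun i => a + r i)).
- by move=> i; have [? [? ?]] := lr i; do !split; lra.
- move: tlr => /trivIsetP tlr; apply/trivIsetP => i j _ _ ij.
  have := tlr i j I I ij; apply: contraPP => /eqP/set0P[x]/=.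
  rewrite !in_itv/= => -[h1 h2]; apply/eqP/set0P; exists (x - a) => /=.
  by rewrite !in_itv/=; split; lra.
- by under eq_bigr => i _ do rewrite opprD addrACA subrr add0r.
Qed.

Lemma is_derive_translation (V : normedModType R) (g : R -> V) (a t : R) dg :
  is_derive (a + t) (1 : R) g dg -> is_derive t (1 : R) (fun s => g (a + s)) dg.
Proof.
have e : (fun h : R =>
      h^-1 *: (((fun s => g (a + s)) \o shift t) (h *: 1) - g (a + t))) =
    (fun h : R => h^-1 *: ((g \o shift (a + t)) (h *: 1) - g (a + t))).
  by apply/funext => h /=; rewrite addrCA.
by case=> dvg <-; apply: DeriveDef; rewrite /derivable /derive e.
Qed.

(** Time invariance, which allows the estimate of the first period to be applied
    again from the history reached at time a. *)
Lemma is_solution_translation n m p (Delta : R) (A : 'I_p -> 'M[R]_n)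
    (d : 'I_p -> R) (f : (R -> 'cV[R]_n) -> 'cV[R]_m -> 'cV[R]_n)
    (u : R -> 'cV[R]_m) xi (b : \bar R) x (a : R) : 0 <= a ->
  is_solution Delta A d f u xi b x ->
  is_solution Delta A d f (fun t => u (a + t)) (hist x a) (b - a%:E)%E
    (fun t => x (a + t)).
Proof.
move=> a0 [cx xxi acx dx].
have ltb (t : R) : (t%:E < b - a%:E)%E = ((a + t)%:E < b)%E.
  by rewrite lteBrDr// -EFinD addrC.
have hE t : hist (fun t => x (a + t)) t = hist x (a + t).
  by apply/funext => s; rewrite /hist addrA.
split.
- apply: (@within_continuous_shift _ _ _ _ x a cx) => s [Ds sb] /=.
  by rewrite -ltb; split => //; lra.
- by [].
- move=> c c0; rewrite ltb => cb.
  under eq_fun do rewrite hE.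
  apply: (@absolutely_continuous_translation _ a c (fun t => Dop A d (hist x t))) => //.
  by apply: acx => //; lra.
- have := ae_translation a dx; apply: filterS => t Ht t0; rewrite ltb => tb.
  under eq_fun do rewrite hE; rewrite hE.
  exact: (@is_derive_translation _ (fun t => Dop A d (hist x t)) _ _ _
    (Ht (addr_ge0 a0 t0) tb)).
Qed.

End translation.

(** * Iteration over successive periods *)

Section input_to_state_bound.
Context {R : realType} {n m p : nat}.
Notation mu := (@lebesgue_measure R).

(** Over each period T0 the norm of the history is halved up to an error C l.
    After k periods the initial history counts with the factor 2^-k, and the
    errors sum to C (1 + 1/2 + ... + 2^-(k-1)) = 2 C (1 - 2^-k); within the next
    period they are amplified by at most M, and a last error C l is added. *)
Lemma iterated_bound (Delta : R) (d : 'I_p -> R) (A : 'I_p -> 'M[R]_n)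
    (f : (R -> 'cV[R]_n) -> 'cV[R]_m -> 'cV[R]_n) (L : R -> R) (M C T0 : R) :
  0 < Delta -> Delta <= T0 -> 0 < M -> 0 <= C ->
  (forall u xi b x l t, histC Delta xi -> is_solution Delta A d f u xi b x ->
     0 <= l -> 0 <= t -> t <= T0 -> (t%:E < b)%E ->
     {ae mu, forall s : R, 0 <= s -> s < t -> L (enorm (u s)) <= l} ->
     enorm (x t) <= M * supnorm Delta xi + C * l /\
     (T0 - Delta <= t -> enorm (x t) <= 2^-1 * supnorm Delta xi + C * l)) ->
  forall (k : nat) u xi b x l t, histC Delta xi -> is_solution Delta A d f u xi b x ->
    0 <= l -> k%:R * T0 <= t -> t <= k.+1%:R * T0 -> (t%:E < b)%E ->
    {ae mu, forall s : R, 0 <= s -> s < t -> L (enorm (u s)) <= l} ->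
    enorm (x t) <= M * 2^-1 ^+ k * supnorm Delta xi
                   + (C + 2 * M * C * (1 - 2^-1 ^+ k)) * l.
Proof.
move=> D0 DT0 M0 C0 step; have T00 : 0 <= T0 by lra.
elim=> [|k IH] u xi b x l t cxi sx l0 kt tk tb ul.
  rewrite expr0 subrr mulr0 addr0 mulr1.
  rewrite mul0r in kt; rewrite mul1r in tk.
  by have [] := step u xi b x l t cxi sx l0 kt tk tb ul.
have Tt : T0 <= t.
  by apply: le_trans kt; rewrite ler_peMl// ler1n.
have Tb : (T0%:E < b)%E by apply: le_lt_trans tb; rewrite lee_fin.
have sx' := is_solution_translation T00 sx.
have [cx _ _ _] := sx.
have cx' : histC Delta (hist x T0).
  apply: (within_continuous_shift cx) => s/=; rewrite in_itv/= => /andP[s1 s2].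
  split; first lra.
  by apply: le_lt_trans Tb; rewrite lee_fin; lra.
(* The whole history at T0 lies in the part of the first period on which the
   halved bound is available. *)
have supx' : supnorm Delta (hist x T0) <= 2^-1 * supnorm Delta xi + C * l.
  apply: supnorm_le; [exact: ltW|move=> tau /andP[t1 t2]].
  have tT : T0 + tau <= T0 by lra.
  have [||||_] := step u xi b x l (T0 + tau) cxi sx l0.
  - lra.
  - by [].
  - by apply: le_lt_trans Tb; rewrite lee_fin.
  - by apply: filterS ul => s us s0 sT; apply: us => //; lra.
  - by apply; lra.
have tb' : ((t - T0)%:E < b - T0%:E)%E by rewrite lteBrDr// -EFinD subrK.
have k1 : k%:R * T0 <= t - T0 by move: kt; rewrite -natr1 mulrDl; lra.
have k2 : t - T0 <= k.+1%:R * T0 by move: tk; rewrite -[k.+2%:R]natr1 mulrDl; lra.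
have ul' : {ae mu, forall s : R, 0 <= s -> s < t - T0 -> L (enorm (u (T0 + s))) <= l}.
  by have := ae_translation T0 ul; apply: filterS => s us s0 st; apply: us; lra.
have := IH _ _ _ _ l (t - T0) cx' sx' l0 k1 k2 tb' ul'.
rewrite subrKC => /le_trans; apply.
have q0 : 0 <= 2^-1 ^+ k :> R by rewrite exprn_ge0.
have := ler_wpM2l (mulr_ge0 (ltW M0) q0) supx'.
rewrite exprSr; move: (2^-1 ^+ k) => q; lra.
Qed.

(** Since 1/2 <= e^(-1/2), halving once per period is exponential decay at rate
    1/(2 T0); the factor e^(1/2) accounts for the unfinished period. *)
Lemma half_pow_le_exp (k : nat) (T0 t : R) : 0 < T0 -> t <= k.+1%:R * T0 ->
  2^-1 ^+ k <= expR 2^-1 * expR (- (2 * T0)^-1 * t).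
Proof.
move=> T00 tk; apply: (@le_trans _ _ (expR (- 2^-1) ^+ k)).
  rewrite lerXn2r ?nnegrE ?expR_ge0//.
  by apply: le_trans (expR_ge1Dx _); lra.
rewrite -expRM_natl -expRD ler_expR.
have : (2 * T0)^-1 * t <= (2 * T0)^-1 * (k.+1%:R * T0).
  by rewrite ler_wpM2l// invr_ge0 mulr_ge0// ltW.
have -> : (2 * T0)^-1 * (k.+1%:R * T0) = (k%:R + 1) / 2 by rewrite -natr1; field; lra.
lra.
Qed.

Lemma period_exists (T0 t : R) : 0 < T0 -> 0 <= t ->
  exists k : nat, k%:R * T0 <= t /\ t <= k.+1%:R * T0.
Proof.
move=> T00 t0; have tT : 0 <= t / T0 by rewrite divr_ge0// ltW.
exists (Num.truncn (t / T0)).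
have /andP[h1 h2] := truncn_itv tT.
by rewrite -ler_pdivlMr// h1 -ler_pdivrMr// ltW.
Qed.

(** [input_comparison] over one period, combined with the decay of the zero-input
    solution, supplies the hypothesis of [iterated_bound]. *)
Lemma input_to_state_bound (Delta : R) (d : 'I_p -> R) (A : 'I_p -> 'M[R]_n)
    (f : (R -> 'cV[R]_n) -> 'cV[R]_m -> 'cV[R]_n) (L0 : R) (L : R -> R) :
  0 < Delta -> (forall j, 0 < d j <= Delta) -> 0 <= L0 ->
  (forall phi1 phi2 u, histC Delta phi1 -> histC Delta phi2 ->
     enorm (f phi1 u - f phi2 0) <= L0 * supnorm Delta (phi1 \- phi2) + L (enorm u)) ->
  GES0 Delta A d f ->
  exists C1 C2 q : R, [/\ 0 < C1, 0 < C2, 0 < q &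
    forall u xi b x l t, histC Delta xi -> is_solution Delta A d f u xi b x ->
      0 <= l -> 0 <= t -> (t%:E < b)%E ->
      {ae mu, forall s : R, 0 <= s -> s < t -> L (enorm (u s)) <= l} ->
      enorm (x t) <= C1 * expR (- q * t) * supnorm Delta xi + C2 * l].
Proof.
move=> D0 dD L00 fL [M [q0 [M0 q00 ges]]].
(* After the time 2 M / q0 the zero-input solution has decayed by
   M e^(-2 M) <= 1/2; one more delay makes the whole history small. *)
pose T0 := Delta + 2 * M / q0.
have Mq : 0 < 2 * M / q0 by rewrite divr_gt0// mulr_gt0.
have T00 : 0 < T0 by rewrite /T0; lra.
have [C C0 cmp] := input_comparison A D0 dD L00 fL (ltW T00).
have half : M * expR (- (2 * M)) <= 2^-1.
  have M2 : 0 < 2 * M by lra.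
  apply: (@le_trans _ _ (M * (2 * M)^-1)).
    rewrite (ler_wpM2l (ltW M0))// expRN lef_pV2 ?posrE ?expR_gt0//.
    by apply: le_trans (expR_ge1Dx _); lra.
  by rewrite invfM mulrCA divff ?mulr1// gt_eqF.
exists (M * expR 2^-1), (C + 2 * M * C + 1), (2 * T0)^-1; split.
- by rewrite mulr_gt0 ?expR_gt0.
- by have := mulr_ge0 (ltW M0) C0; lra.
- by rewrite invr_gt0 mulr_gt0.
move=> u xi b x l t cxi sx l0 t0 tb ul.
have sxi := supnorm_ge0 (ltW D0) cxi.
have [k [kt tk]] := period_exists T00 t0.
have := @iterated_bound Delta d A f L M C T0 D0 _ M0 C0 _ k u xi b x l t
  cxi sx l0 kt tk tb ul.
have DT : Delta <= T0 by rewrite /T0; lra.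
move=> /(_ DT) H; apply: le_trans (H _) _; last first.
  have q1 : 0 <= 2^-1 ^+ k :> R by rewrite exprn_ge0.
  have := half_pow_le_exp T00 tk; rewrite -(mulrA M (expR 2^-1)).
  move: q1; move: (2^-1 ^+ k) (expR 2^-1 * _) => a e a0 ae.
  apply: lerD; first by rewrite ler_wpM2r// ler_wpM2l// ltW.
  rewrite ler_wpM2r//.
  have := mulr_ge0 (mulr_ge0 (ltW M0) C0) a0; lra.
move=> {H sx cxi l0 t0 tb ul kt tk xi u b x l t sxi} u xi b x l t cxi sx l0 t0 tT tb ul.
have [[y sy] yM] := ges xi cxi.
have cmp' := cmp u xi b x y l t sx sy l0 t0 tT tb ul.
have yM' := yM +oo%E y (ltry _) sy t t0 (ltry _).
have sxi := supnorm_ge0 (ltW D0) cxi.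
have xt : enorm (x t) <= enorm (y t) + C * l.
  rewrite -(subrK (y t) (x t)) addrC (le_trans (enormD _ _))//.
  by rewrite lerD2l.
suff [h1 h2] : M * expR (- q0 * t) <= M /\
    (T0 - Delta <= t -> M * expR (- q0 * t) <= 2^-1).
  split=> [|/h2 {}h2]; apply: (le_trans xt); rewrite lerD2r;
    by apply: (le_trans yM'); rewrite ler_wpM2r.
split=> [|tD].
  by rewrite (ler_piMr (ltW M0))// -expR0 ler_expR mulNr oppr_le0 mulr_ge0// ltW.
apply: le_trans half; rewrite (ler_wpM2l (ltW M0))// ler_expR mulNr lerN2.
have -> : 2 * M = q0 * (T0 - Delta) by rewrite /T0; field; lra.
by rewrite ler_wpM2l// ltW.
Qed.

End input_to_state_bound.

(** * Borel representatives of inputs *)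

Section inputs.
Context {R : realType}.
Notation mu := (@lebesgue_measure R).

Lemma lebesgue_measureT_gt0 : (0 < mu setT)%E.
Proof.
by rewrite -set_itvNyy lebesgue_measure_itv/= addye// ltry.
Qed.

(** For T > 0 finiteness is the local essential boundedness of the input; for
    T = 0 the truncation vanishes. *)
Lemma ess_norm_spec m (u : R -> 'cV[R]_m) (T : R) : input u -> 0 <= T ->
  0 <= fine (ess_norm (truncate u 0 T)) /\
  {ae mu, forall s : R, 0 <= s -> s < T ->
     enorm (u s) <= fine (ess_norm (truncate u 0 T))}.
Proof.
move=> [_ bu] T0; set N := ess_norm _.
have N0 : (0 <= N)%E.
  apply: (ess_sup_gee lebesgue_measureT_gt0).
  by apply: nearW => s /=; rewrite lee_fin enorm_ge0.
have Noo : (N < +oo)%E.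
  move: T0; rewrite le_eqVlt => /predU1P[T0|]; last exact: bu.
  rewrite /N /ess_norm (_ : (fun t => _) = cst 0%E).
    by rewrite ess_sup_cst ?ltry//; exact: lebesgue_measureT_gt0.
  apply/funext => s; rewrite /truncate -T0 ifF ?enorm0//.
  by apply/negbTE/negP => /andP[s1]; rewrite ltNge s1.
have Nfin : N = (fine N)%:E by rewrite fineK// ge0_fin_numE.
split; first exact: fine_ge0.
have := @ess_sup_ge _ _ R mu (fun t => (enorm (truncate u 0 T t))%:E).
apply: filterS => s + s0 sT; rewrite -/(ess_norm _) -/N Nfin lee_fin.
by rewrite /truncate s0 sT.
Qed.

Lemma negligible_countable (J : countType) (F : J -> set R) :
  (forall j, mu.-negligible (F j)) -> mu.-negligible (\bigcup_j F j).
Proof.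
move=> negF.
pose G n := if unpickle n is Some j then F j else set0.
apply: (@negligibleS _ (measurableTypeR R) R mu (\bigcup_n G n)).
  by move=> t [j _ Fjt]; exists (pickle j) => //; rewrite /G pickleK.
apply: negligible_bigcup => n; rewrite /G; case: unpickle => // .
exact: negligible_set0.
Qed.

Lemma lebesgue_measurable_decomp m (u : R -> 'cV[R]_m) i (Y : set R) :
  lebesgue_measurable u -> measurable Y ->
  exists2 B : set R, measurable B & exists2 N, mu.-negligible N &
    B `|` N = `[0, +oo[ `&` [set t | Y (u t i 0)].
Proof.
move=> mu_ mY.
have borel (B : set R) : measurable B ->
    (completed_algebra_gen mu).-sigma.-measurable B.
  rewrite g_sigma_completed_algebra_genE => mB; exists B => //.
  by exists set0; [exact: negligible_set0|rewrite setU0].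
have : (completed_algebra_gen mu).-sigma.-measurable
    (`[0, +oo[ `&` [set t | Y (u t i 0)]).
  exact: (mu_ i (borel _ (measurable_itv `[0, +oo[)) Y mY).
by rewrite g_sigma_completed_algebra_genE => -[B mB [N nN BN]];
  exists B => //; exists N.
Qed.

(** One Borel null set W contains the defects of all the sublevel sets
    {u_i < q}, q rational, and all the points where u exceeds its essential
    bound on some [0, k).  Setting u to 0 on W makes it Borel and bounded on
    bounded intervals. *)
Lemma borel_version m (u : R -> 'cV[R]_m) : input u ->
  exists v : R -> 'cV[R]_m, [/\
    forall i, measurable_fun setT (fun t => v t i 0),
    forall T, exists C, forall t, `|t| <= T -> enorm (v t) <= C &
    {ae mu, forall t : R, 0 <= t -> v t = u t}].
Proof.
move=> iu; have [mu_ bu] := iu.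
have dec (j : 'I_m * rat) := lebesgue_measurable_decomp j.1 mu_
  (measurable_itv `]-oo, (ratr j.2 : R)[).
pose B j := sval (cid2 (dec j)); have BP j := svalP (cid2 (dec j)).
have mB j : measurable (B j) by rewrite /B; case: cid2.
have BN j : exists2 N, mu.-negligible N &
    B j `|` N = `[0, +oo[ `&` [set t | `]-oo, (ratr j.2 : R)[%classic (u t j.1 0)].
  by rewrite /B; case: cid2.
pose N j := sval (cid2 (BN j)).
have nN j : mu.-negligible (N j) by rewrite /N; case: cid2.
have BNE j : B j `|` N j =
    `[0, +oo[ `&` [set t | `]-oo, (ratr j.2 : R)[%classic (u t j.1 0)].
  by rewrite /N; case: cid2.
pose c (k : nat) := fine (ess_norm (truncate u 0 k%:R)).
have nE (k : nat) :
    mu.-negligible [set s | ~ (0 <= s -> s < k%:R -> enorm (u s) <= c k)].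
  by have [_] := ess_norm_spec iu (ler0n R k).
have [W [mW W0 NW]] := negligibleU (negligible_countable nN) (negligible_countable nE).
pose v t := if (0 <= t) && (t \notin W) then u t else 0.
exists v; split.
- move=> i; apply: (measurability _ (RGenInftyO.measurableE R)) => //.
  move=> _ [_ [y ->] <-]; rewrite setTI.
  have -> : (fun t => v t i 0) @^-1` `]-oo, y[ =
      ((\bigcup_(q : rat) (if ratr q < y then B (i, q) else set0)) `\` W) `|`
      ((W `|` `]-oo, 0[) `&` (if 0 < y then setT else set0)).
    have Wle j t : (B j `|` N j) t -> ~ W t -> B j t.
      by move=> [//|Nt] Wt; exfalso; apply: Wt; apply: NW; left; exists j.
    apply/seteqP; split => t /=; rewrite in_itv/= /v.
    + case: ifPn => [/andP[t0 tW] uty|tW].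
        left; split; last by move/mem_set; exact/negP.
        have [q] := rat_in_itvoo uty; rewrite in_itv/= => /andP[uq qy].
        exists q => //; rewrite qy; apply: Wle.
          by rewrite BNE/=; split; rewrite /= in_itv/= ?t0.
        by move/mem_set; exact/negP.
      rewrite mxE => y0; right; rewrite y0; split => //.
      by move: tW; rewrite negb_and -ltNge negbK in_itv/=;
        move=> /orP[?|/set_mem]; [right|left].
    + move=> [[[q _]]|[]].
        case: ifP => // qy Bt Wt.
        have : (B (i, q) `|` N (i, q)) t by left.
        rewrite BNE/= !in_itv/= andbT => -[t0 utq].
        by rewrite t0 (introT negP)/= ?(lt_trans utq)// => /set_mem.
      case: ifP => // y0 Wt _; rewrite ifF ?mxE//.
      apply/negbTE; rewrite negb_and -ltNge negbK.
      by case: Wt => [/mem_set->|]; [rewrite orbT|move=> ->].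
  apply: measurableU.
    apply: measurableD => //; apply: bigcupT_measurable_rat => q.
    by case: ifP.
  apply: measurableI; first by apply: measurableU.
  by case: ifP.
- move=> T.
  exists (Num.max 0 (c (Num.truncn T).+1)) => t tT.
  rewrite /v; case: ifPn => [/andP[t0 tW]|_]; last by rewrite enorm0 le_max lexx.
  rewrite le_max; apply/orP; right.
  have T0 : 0 <= T by rewrite (le_trans _ tT).
  apply: contrapT => h; move/negP: tW; apply; apply/mem_set; apply: NW; right.
  exists (Num.truncn T).+1 => //= H; apply: h; apply: H => //.
  rewrite ger0_norm// in tT; apply: le_lt_trans tT _.
  by have /andP[_] := truncn_itv T0.
- exists W; split => // t /= Ht; apply: contrapT => Wt; apply: Ht => t0.
  by rewrite /v t0 (introT negP)// => /set_mem.
Qed.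

End inputs.

(** * Measurability of the right-hand side along a trajectory *)

Section measurable_superposition.
Context {R : realType}.
Notation mu := (@lebesgue_measure R).

Lemma continuous_epsP (V : normedModType R) (x : R -> V) :
  continuous x <-> forall s e : R, 0 < e ->
    exists2 eta : R, 0 < eta & forall t, `|t - s| < eta -> `|x t - x s| <= e.
Proof.
split=> [cx s e e0|H s].
  have /within_continuousP /(_ s I e e0)[eta eta0 h] : {within setT, continuous x}.
    exact: continuous_subspaceT.
  by exists eta => // t; exact: h.
apply/cvgrPdist_le => e e0; have [eta eta0 h] := H s e e0.
apply/nbhs_ballP; exists eta => //= t; rewrite /ball/= distrC => st.
by rewrite distrC; exact: h.
Qed.

Lemma continuous_histC n (r : R) (x : R -> 'cV[R]_n) t :
  continuous x -> histC r (hist x t).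
Proof.
move=> cx; apply: (@within_continuous_shift _ _ setT _ x t) => //.
exact: continuous_subspaceT.
Qed.

Lemma continuous_bounded_itv n (x : R -> 'cV[R]_n) (a b : R) : continuous x ->
  exists2 H : R, 0 < H & forall s, a <= s -> s <= b -> `|x s| <= H.
Proof.
move=> cx; have [ab|ba] := leP a b; last by exists 1 => // s sa sb; lra.
have : {within `[a, b], continuous (fun t => `|x t|)}.
  apply: continuous_subspaceT => t.
  by apply: (continuous_comp (cx t)); exact: norm_continuous.
move=> /(EVT_max ab)[c _ hc]; exists (`|x c| + 1).
  by rewrite ltr_wpDl.
by move=> s sa sb; rewrite (le_trans (hc s _)) ?in_itv/= ?sa// lerDl.
Qed.

(** The histories of a continuous function depend continuously on time, for the
    supremum norm.  The uniformity in tau comes from [interval_induction] on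
    the length of the part of the history where it is known. *)
Lemma hist_equicontinuous n (r : R) (x : R -> 'cV[R]_n) (t e : R) :
  0 <= r -> continuous x -> 0 < e ->
  exists2 eta : R, 0 < eta & forall s, `|s - t| < eta ->
    forall tau, - r <= tau <= 0 -> `|x (s + tau) - x (t + tau)| <= e.
Proof.
move=> r0 /continuous_epsP cx e0.
suff [eta eta0 h] : exists2 eta : R, 0 < eta & forall s, `|s - t| < eta ->
    forall sigma, 0 <= sigma <= r -> `|x (s - sigma) - x (t - sigma)| <= e.
  exists eta => // s st tau /andP[rt t0].
  by have := h s st (- tau); rewrite !opprK; apply; apply/andP; split; lra.
have local a : exists2 eta : R, 0 < eta & forall s sigma, `|s - t| < eta ->
    `|sigma - a| < eta -> `|x (s - sigma) - x (t - sigma)| <= e.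
  have [eta eta0 h] := cx (t - a) (e / 2) ltac:(lra).
  exists (eta / 2) => [|s sigma]; first lra.
  move=> /ltr_normlP[s1 s2] /ltr_normlP[s3 s4].
  have h1 := h (s - sigma) ltac:(apply/ltr_normlP; split; lra).
  have h2 := h (t - sigma) ltac:(apply/ltr_normlP; split; lra).
  rewrite -(subrKA (x (t - a))) (le_trans (ler_normD _ _))//.
  by rewrite [e]splitr lerD// distrC.
apply: (@interval_induction _ r (fun c => exists2 eta : R, 0 < eta &
   forall s, `|s - t| < eta ->
     forall sigma, 0 <= sigma <= c -> `|x (s - sigma) - x (t - sigma)| <= e)) => //.
  have [eta eta0 h] := local 0; exists eta => // s st sigma s0.
  by apply: h => //; have -> : sigma = 0 by [lra|]; rewrite subrr normr0.
move=> a /andP[a0 ar]; have [eta eta0 h] := local a.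
exists eta => // c c' ac ca c0 _ _ _ [eta' eta'0 h'].
exists (Num.min eta eta'); first by rewrite lt_min eta0.
move=> s; rewrite lt_min => /andP[s1 s2] sigma /andP[g0 g1].
have [gc|cg] := leP sigma c; first by apply: h' => //; rewrite g0.
by apply: h => //; apply/ltr_normlP; split; lra.
Qed.

Lemma measurable_fun_countable_range d (T : measurableType d) (J : countType)
    (idx : T -> J) (F : J -> R) :
  (forall j, measurable [set t | idx t = j]) -> measurable_fun setT (F \o idx).
Proof.
move=> midx _ Y mY; rewrite setTI.
rewrite (_ : _ @^-1` _ =
    \bigcup_j (if pselect (Y (F j)) then [set t | idx t = j] else set0)).
  apply: countable_bigcupT_measurable; first exact: countableP.
  by move=> j; case: pselect => [? /=|? /=]; [exact: midx|exact: measurable0].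
apply/seteqP; split => t /=.
  by move=> Yt; exists (idx t) => //; case: pselect.
by move=> [j _]; case: pselect => //= Yj ->.
Qed.

Lemma measurable_floor_eq d (T : measurableType d) (h : T -> R) (a : int) :
  measurable_fun setT h -> measurable [set t | Num.floor (h t) = a].
Proof.
move=> mh; rewrite (_ : mkset _ = setT `&` h @^-1` `[a%:~R, (a + 1)%:~R[).
  exact: mh.
rewrite setTI; apply/seteqP; split => t /=; rewrite in_itv/= -floor_eq.
  by move=> /eqP.
by move/eqP.
Qed.

Lemma grid_dist (k : nat) (r : R) :
  `|(Num.floor (r * k.+1%:R))%:~R / k.+1%:R - r| <= k.+1%:R^-1.
Proof.
have /andP[h1 h2] := floor_itv (r * k.+1%:R).
have k0 : 0 < k.+1%:R :> R by [].
have -> : (Num.floor (r * k.+1%:R))%:~R / k.+1%:R - r =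
    ((Num.floor (r * k.+1%:R))%:~R - r * k.+1%:R) / k.+1%:R by field.
rewrite normrM normfV (ger0_norm (ltW k0)) ler_piMl ?invr_ge0// ler_norml.
by move: h2; rewrite intrD; lra.
Qed.

(** A jointly continuous F(t, w) composed with a measurable v: rounding t and
    the coordinates of v(t) to multiples of 1/(k+1) gives functions with
    countably many values, and these converge to F(t, v(t)). *)
Lemma measurable_superposition m (F : R -> 'cV[R]_m -> R) (v : R -> 'cV[R]_m) :
  (forall t w e, 0 < e -> exists2 eta : R, 0 < eta & forall s w',
     `|s - t| < eta -> `|w' - w| < eta -> `|F s w' - F t w| <= e) ->
  (forall i, measurable_fun setT (fun t => v t i 0)) ->
  measurable_fun setT (fun t => F t (v t)).
Proof.
move=> cF mv.
pose idx (k : nat) (t : R) : (int * {ffun 'I_m -> int})%type :=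
  (Num.floor (t * k.+1%:R), [ffun i => Num.floor (v t i 0 * k.+1%:R)]).
pose G (k : nat) (j : (int * {ffun 'I_m -> int})%type) :=
  F (j.1%:~R / k.+1%:R) (\col_i ((j.2 i)%:~R / k.+1%:R)).
apply: (@measurable_fun_cvg _ (measurableTypeR R) R setT (fun k => G k \o idx k)).
  move=> k; apply: measurable_fun_countable_range => -[a b].
  have -> : [set t | idx k t = (a, b)] =
      [set t | Num.floor (t * k.+1%:R) = a] `&`
      \bigcap_(i in [set: 'I_m]) [set t | Num.floor (v t i 0 * k.+1%:R) = b i].
    apply/seteqP; split => t.
      by move=> [<- <-]; split => //= i _; rewrite ffunE.
    move=> [/= h1 h2]; rewrite /idx h1; congr (_, _); apply/ffunP => i.
    by rewrite ffunE h2.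
  apply: measurableI.
    by apply: measurable_floor_eq; apply: measurable_funM.
  apply: fin_bigcap_measurable => // i _; apply: measurable_floor_eq.
  by apply: measurable_funM => //; exact: mv.
move=> t _; apply/cvgrPdist_le => e e0; have [eta eta0 h] := cF t (v t) e e0.
have := near_infty_natSinv_lt (PosNum eta0); apply: filterS => k /= ke.
rewrite distrC; apply: h; first exact: le_lt_trans (grid_dist _ _) ke.
apply: le_lt_trans ke; apply: mxnorm_le => [|i j]; first by rewrite invr_ge0.
by rewrite !mxE ffunE (ord1 j) grid_dist.
Qed.

(** By the Lipschitz condition, f(x_t, w) is jointly continuous in t and w. *)
Lemma measurable_field n m (Delta : R) (f : (R -> 'cV[R]_n) -> 'cV[R]_m -> 'cV[R]_n)
    (x : R -> 'cV[R]_n) (v : R -> 'cV[R]_m) :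
  0 < Delta -> lip_on_bounded Delta f -> continuous x ->
  (forall i, measurable_fun setT (fun t => v t i 0)) ->
  forall i, measurable_fun setT (fun t => f (hist x t) (v t) i 0).
Proof.
move=> D0 lf cx mv i.
apply: (@measurable_superposition m (fun t w => f (hist x t) w i 0)) => // t w e e0.
have [H H0 xH] := continuous_bounded_itv (t - Delta - 1) (t + 1) cx.
have [||L L0 hL] := lf (n%:R * H + 1) (m%:R * (`|w| + 1) + 1).
- by rewrite ltr_wpDl// mulr_ge0// ltW.
- by rewrite ltr_wpDl// mulr_ge0.
pose e' := e / (L * (n%:R + m%:R + 1)).
have q0 : 0 < L * (n%:R + m%:R + 1) by rewrite mulr_gt0// ltr_wpDl.
have e'0 : 0 < e' by rewrite divr_gt0.
have [eta eta0 h] := hist_equicontinuous t (ltW D0) cx e'0.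
exists (Num.min (Num.min eta e') 1).
  by rewrite !lt_min eta0 e'0 ltr01.
move=> s w'; rewrite !lt_min => /andP[/andP[s1 s2] s3] /andP[/andP[w1 w2] w3].
apply: (@le_trans _ _ (enorm (f (hist x s) w' - f (hist x t) w))).
  apply: le_trans (mxnorm_le_enorm _); rewrite -[leLHS]/(`|_|).
  by have := mxnorm_coord (f (hist x s) w' - f (hist x t) w) i 0; rewrite !mxE.
have bx r : `|r - t| < 1 -> supnorm Delta (hist x r) <= n%:R * H + 1.
  move=> /ltr_normlP[r1 r2]; apply: (@le_trans _ _ (n%:R * H)); last by rewrite lerDl.
  by apply: supnorm_le_mxnorm => [|tau /andP[? ?]]; [exact: ltW|apply: xH; lra].
have bw (z : 'cV[R]_m) : `|z| <= `|w| + 1 -> enorm z <= m%:R * (`|w| + 1) + 1.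
  move=> zw; apply: (le_trans (enorm_le_mxnorm _)).
  by apply: le_trans (ler_wpM2l (ler0n R m) zw) _; rewrite lerDl.
have bt : supnorm Delta (hist x t) <= n%:R * H + 1 by apply: bx; rewrite subrr normr0.
have bw' : enorm w' <= m%:R * (`|w| + 1) + 1.
  apply: bw; rewrite -{1}(subrK w w') (le_trans (ler_normD _ _))// addrC.
  by rewrite lerD2l ltW.
have bw0 : enorm w <= m%:R * (`|w| + 1) + 1 by apply: bw; rewrite lerDl.
have hf := hL (hist x s) (hist x t) w' w (continuous_histC cx)
  (continuous_histC cx) (bx s s3) bt bw' bw0.
refine (le_trans hf _).
have hs : supnorm Delta (hist x s \- hist x t) <= n%:R * e'.
  by apply: supnorm_le_mxnorm; [exact: ltW|exact: h].
have hw : enorm (w' - w) <= m%:R * e'.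
  by rewrite (le_trans (enorm_le_mxnorm _))// ler_wpM2l// ltW.
have nm0 : 0 < n%:R + m%:R + 1 :> R by rewrite ltr_wpDl.
have -> : e = L * (n%:R * e' + m%:R * e' + e').
  by rewrite /e'; field; rewrite !gt_eqF.
rewrite (ler_wpM2l (ltW L0))//; lra.
Qed.

End measurable_superposition.

(** * Geometric convergence, continuity and differentiability *)

Section geometric_sequences.
Context {R : realType}.

Lemma le_add_geometric (r b C : R) :
  (forall k : nat, r <= b + C * 2^-1 ^+ k) -> r <= b.
Proof.
move=> H; apply/ler_addgt0Pr => e e0; have [C0|C0] := leP C 0.
  have := H 0%N; rewrite expr0 mulr1; lra.
have eC0 : 0 < e / C by rewrite divr_gt0.
have [k _ hk] := near_infty_natSinv_expn_lt (PosNum eC0).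
apply: le_trans (H k) _; rewrite lerD2l mulrC -ler_pdivlMr//.
by have := hk k (leqnn k); rewrite /= div1r exprVn => /ltW.
Qed.

Lemma geometric_telescope (V : normedModType R) (a : nat -> V) (C : R) :
  (forall k, `|a k.+1 - a k| <= C * 2^-1 ^+ k) ->
  forall k j, `|a (k + j)%N - a k| <= 2 * C * (2^-1 ^+ k - 2^-1 ^+ (k + j)).
Proof.
move=> aC k; elim=> [|j IH]; first by rewrite addn0 !subrr normr0 mulr0.
rewrite addnS -(subrKA (a (k + j)%N)) (le_trans (ler_normD _ _))//.
have := aC (k + j)%N; rewrite exprSr; lra.
Qed.

(** The numbers a_k - 2 C 2^-k increase, the numbers a_k + 2 C 2^-k decrease, and
    the limit lies between them. *)
Lemma geometric_limit_scalar (a : nat -> R) (C : R) :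
  (forall k, `|a k.+1 - a k| <= C * 2^-1 ^+ k) ->
  exists l, forall k, `|a k - l| <= 2 * C * 2^-1 ^+ k.
Proof.
move=> aC; have tel := geometric_telescope aC.
have C0 : 0 <= C by have := aC 0%N; rewrite expr0 mulr1; apply: le_trans.
have q0 k : 0 <= 2 * C * 2^-1 ^+ k by rewrite !mulr_ge0// exprn_ge0.
have mono j k : a j - 2 * C * 2^-1 ^+ j <= a k + 2 * C * 2^-1 ^+ k.
  have [jk|/ltnW kj] := leqP j k.
    have /ler_normlP[] := tel j (k - j)%N; rewrite subnKC//.
    by have := q0 k; have := q0 j; lra.
  have /ler_normlP[] := tel k (j - k)%N; rewrite subnKC//.
  by have := q0 k; have := q0 j; lra.
pose S := [set a k - 2 * C * 2^-1 ^+ k | k in [set: nat]].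
have S0 : S !=set0 by exists (a 0%N - 2 * C * 2^-1 ^+ 0), 0%N.
have hS : has_sup S.
  by split => //; exists (a 0%N + 2 * C * 2^-1 ^+ 0) => _ [k _ <-].
exists (sup S) => k; rewrite ler_norml.
have h1 : a k - 2 * C * 2^-1 ^+ k <= sup S.
  by apply: (sup_upper_bound hS); exists k.
have h2 : sup S <= a k + 2 * C * 2^-1 ^+ k by apply: ge_sup => // _ [j _ <-].
by lra.
Qed.

(** One limit serves all the admissible constants C.  The iterates below satisfy
    the hypothesis at time s with a constant for each horizon T >= s, and the
    limit has to be the same for all of them. *)
Lemma geometric_limit n (a : nat -> 'cV[R]_n) :
  (exists C, forall k, `|a k.+1 - a k| <= C * 2^-1 ^+ k) ->
  exists l, forall C, (forall k, `|a k.+1 - a k| <= C * 2^-1 ^+ k) ->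
    forall k, `|a k - l| <= 2 * C * 2^-1 ^+ k.
Proof.
move=> [C0 aC0].
have lim i : exists l, forall k, `|a k i 0 - l| <= 2 * C0 * 2^-1 ^+ k.
  apply: geometric_limit_scalar => k; apply: le_trans (aC0 k).
  by have := mxnorm_coord (a k.+1 - a k) i 0; rewrite !mxE.
have C00 : 0 <= C0 by have := aC0 0%N; rewrite expr0 mulr1; apply: le_trans.
pose l : 'cV[R]_n := \col_i sval (cid (lim i)).
have lP k : `|a k - l| <= 2 * C0 * 2^-1 ^+ k.
  apply: mxnorm_le => [|i j]; first by rewrite !mulr_ge0// exprn_ge0.
  by rewrite !mxE (ord1 j); exact: (svalP (cid (lim i))).
exists l => C aC k.
have CC : 0 <= C by have := aC 0%N; rewrite expr0 mulr1; apply: le_trans.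
apply: (@le_add_geometric _ _ (2 * C0)) => j.
rewrite -(subrKA (a (k + j)%N)) (le_trans (ler_normD _ _))// lerD//.
  rewrite distrC (le_trans (geometric_telescope aC k j))//.
  by rewrite ler_wpM2l ?mulr_ge0// gerBl exprn_ge0.
apply: le_trans (lP _) _; rewrite ler_wpM2l ?mulr_ge0// exprD.
by rewrite ler_piMl ?exprn_ge0// exprn_ile1//; lra.
Qed.

Lemma continuous_mulmx n (B : 'M[R]_n) (y : R -> 'cV[R]_n) :
  continuous y -> continuous (fun t => B *m y t).
Proof.
move=> /continuous_epsP cy; apply/continuous_epsP => s e e0.
have q0 : 0 < n%:R * `|B| + 1 by rewrite ltr_wpDl// mulr_ge0.
have [eta eta0 h] := cy s _ (divr_gt0 e0 q0); exists eta => // t /h ht.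
rewrite -mulmxBr (le_trans (mxnorm_mul _ _))//.
apply: (@le_trans _ _ ((n%:R * `|B| + 1) * `|y t - y s|)).
  by rewrite ler_wpM2r// lerDl.
by rewrite mulrC -ler_pdivlMr.
Qed.

Lemma continuous_sum (V : normedModType R) k (g : 'I_k -> R -> V) :
  (forall j, continuous (g j)) -> continuous (fun t => \sum_j g j t).
Proof.
elim: k g => [|k IH] g cg.
  have -> : (fun t => \sum_(j < 0) g j t) = cst 0.
    by apply/funext => t; rewrite big_ord0.
  exact: cst_continuous.
have -> : (fun t => \sum_(j < k.+1) g j t) =
    (fun t => g ord0 t + \sum_(j < k) g (lift ord0 j) t).
  by apply/funext => t; rewrite big_ord_recl.
by move=> t; apply: cvgD; [exact: cg|exact: (IH (fun j => g (lift ord0 j)))].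
Qed.

Lemma continuous_of_lipschitz (V : normedModType R) (g : R -> V) :
  (forall T : R, exists2 C, 0 <= C & forall s t, `|s| <= T -> `|t| <= T ->
    `|g t - g s| <= C * `|t - s|) -> continuous g.
Proof.
move=> lg; apply/continuous_epsP => s e e0; have [C C0 h] := lg (`|s| + 1).
have q0 : 0 < C + 1 by lra.
exists (Num.min 1 (e / (C + 1))); first by rewrite lt_min ltr01 divr_gt0.
move=> t; rewrite lt_min => /andP[t1 te].
apply: le_trans (h _ _ _ _) _; first by rewrite lerDl.
  by rewrite -{1}(subrK s t) (le_trans (ler_normD _ _))// addrC lerD2l ltW.
apply: (@le_trans _ _ ((C + 1) * `|t - s|)); first by rewrite ler_wpM2r// lerDl.
by rewrite mulrC -ler_pdivlMr// ltW.
Qed.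

Lemma ler_dist_max (a s t : R) : `|Num.max a t - Num.max a s| <= `|t - s|.
Proof.
have := ler_norm (t - s); have := ler_norm (s - t); rewrite (distrC s t) => h1 h2.
have h3 := normr_ge0 (t - s).
by rewrite ler_norml; case: (leP a t) => ?; case: (leP a s) => ?; lra.
Qed.

Lemma ler_dist_min (a s t : R) : `|Num.min a t - Num.min a s| <= `|t - s|.
Proof.
have := ler_norm (t - s); have := ler_norm (s - t); rewrite (distrC s t) => h1 h2.
have h3 := normr_ge0 (t - s).
by rewrite ler_norml; case: (leP a t) => ?; case: (leP a s) => ?; lra.
Qed.

Lemma eq_absolutely_continuous n (a b : R) (g1 g2 : R -> 'cV[R]_n) :
  (forall t, a <= t -> t <= b -> g1 t = g2 t) ->
  absolutely_continuous a b g1 -> absolutely_continuous a b g2.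
Proof.
move=> g12 ac1 e /ac1[delta delta0 H]; exists delta => // k l r lr tlr s.
rewrite (eq_bigr (fun i => enorm (g1 (r i) - g1 (l i)))); first exact: H.
by move=> i _; have [al [lri rb]] := lr i; rewrite !g12//; lra.
Qed.

Lemma absolutely_continuous_cstD n (a b : R) (c : 'cV[R]_n) (g : R -> 'cV[R]_n) :
  absolutely_continuous a b g -> absolutely_continuous a b (fun t => c + g t).
Proof.
move=> ac e /ac[delta delta0 H]; exists delta => // k l r lr tlr s.
rewrite (eq_bigr (fun i => enorm (g (r i) - g (l i)))); first exact: H.
by move=> i _; rewrite opprD addrACA subrr add0r.
Qed.

Lemma near_is_derive (V : normedModType R) (g1 g2 : R -> V) (t : R) dg (e : R) :
  0 < e -> (forall s, `|s - t| < e -> g1 s = g2 s) ->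
  is_derive t (1 : R) g1 dg -> is_derive t (1 : R) g2 dg.
Proof.
move=> e0 g12 [dv <-].
have ng : {near t, g1 =1 g2}.
  by apply/nbhs_ballP; exists e => //= s; rewrite /ball/= distrC; exact: g12.
by apply: DeriveDef; [exact: near_eq_derivable ng dv|apply/esym/near_eq_derive].
Qed.

End geometric_sequences.

(** * Existence of solutions by successive approximations *)

Section picard.
Context {R : realType} {n m p : nat}.
Notation mu := (@lebesgue_measure R).
Context (Delta : R) (Delta_gt0 : 0 < Delta)
  (d : 'I_p -> R) (d_bounds : forall j, 0 < d j <= Delta)
  (A : 'I_p -> 'M[R]_n)
  (f : (R -> 'cV[R]_n) -> 'cV[R]_m -> 'cV[R]_n)
  (f_lip : lip_on_bounded Delta f)
  (L0 : R) (L0_ge0 : 0 <= L0) (L : R -> R) (L_ge0 : forall r : R, 0 <= r -> 0 <= L r)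
  (L_mono : forall r s : R, 0 <= r -> r <= s -> L r <= L s)
  (f_growth : forall phi u, histC Delta phi ->
     enorm (f phi u) <= L0 * supnorm Delta phi + L (enorm u))
  (v : R -> 'cV[R]_m)
  (v_meas : forall i, measurable_fun setT (fun t => v t i 0))
  (v_bounded : forall T : R, exists C, forall t, `|t| <= T -> enorm (v t) <= C)
  (xi : R -> 'cV[R]_n) (xi_cont : histC Delta xi).

Let Delta_ge0 : 0 <= Delta. Proof. exact: ltW. Qed.

(** The initial history, extended by constants to the whole line so that every
    iterate is continuous on R. *)
Let x0 (t : R) : 'cV[R]_n := xi (Num.max (- Delta) (Num.min 0 t)).

Let x0_xi (t : R) : - Delta <= t <= 0 -> x0 t = xi t.
Proof. by move=> /andP[Dt t0]; rewrite /x0 min_r// max_r. Qed.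

Let x0_pos (t : R) : 0 <= t -> x0 t = xi 0.
Proof. by move=> t0; rewrite /x0 min_l// max_r// oppr_le0. Qed.

Let clamp_itv (t : R) : - Delta <= Num.max (- Delta) (Num.min 0 t) <= 0.
Proof. by rewrite le_max lexx/= ge_max oppr_le0 Delta_ge0 ge_min lexx. Qed.

Let x0_cont : continuous x0.
Proof.
apply/continuous_epsP => s e e0.
have /within_continuousP h := xi_cont.
have B t : `[- Delta, 0]%classic (Num.max (- Delta) (Num.min 0 t)).
  by rewrite /= in_itv/= clamp_itv.
have [eta eta0 h'] := h _ (B s) e e0.
exists eta => // t ts; apply: h' (B t) _.
by rewrite (le_lt_trans (ler_dist_max _ _ _))// (le_lt_trans (ler_dist_min _ _ _)).
Qed.

Let x0_bounded (t : R) : `|x0 t| <= supnorm Delta xi.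
Proof.
apply: (le_trans (mxnorm_le_enorm _)).
exact: (supnorm_ge xi_cont (clamp_itv t)).
Qed.

Let Dxi : 'cV[R]_n := x0 0 - \sum_j A j *m x0 (- d j).

Let Zspec (x F : R -> 'cV[R]_n) := [/\ F 0 = 0,
    forall T : R, exists2 C, 0 <= C &
      forall s t : R, 0 <= s -> s <= T -> 0 <= t -> t <= T ->
      `|F t - F s| <= C * `|t - s| &
    {ae mu, forall t : R, 0 <= t -> is_derive t (1 : R) F (f (hist x t) (v t))}].

Let Z_exists (x : R -> 'cV[R]_n) : exists F, continuous x -> Zspec x F.
Proof.
have [cx|ncx] := pselect (continuous x); last by exists x0.
have [||F FP] := @antiderivative R n (fun t => f (hist x t) (v t)).
- exact: (measurable_field Delta_gt0 f_lip cx v_meas).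
- move=> T; have [H H0 xH] := continuous_bounded_itv (- T - Delta) T cx.
  have [C vC] := v_bounded T.
  exists (L0 * (n%:R * H) + L (Num.max 0 C)) => t tT.
  have /ler_normlP[t1 t2] := tT.
  apply: (le_trans (mxnorm_le_enorm _)).
  apply: (le_trans (f_growth _ (continuous_histC cx))); apply: lerD.
    rewrite ler_wpM2l//; apply: supnorm_le_mxnorm => // tau /andP[? ?].
    by apply: xH; lra.
  by apply: L_mono; [exact: enorm_ge0|rewrite le_max vC ?orbT].
- by exists F.
Qed.

Let Z (x : R -> 'cV[R]_n) : R -> 'cV[R]_n := sval (cid (Z_exists x)).
Let ZP x : continuous x -> Zspec x (Z x). Proof. exact: (svalP (cid (Z_exists x))). Qed.

(** The Picard operator.  For x with initial history xi it returns, on t <= 0,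
    that history and, on t >= 0, the value
    sum_j A_j x(t - d_j) + D xi + int_0^t f(x_s, v(s)) ds.
    Writing it with max(0, t) makes the two cases one continuous formula; they
    are separated in [P_neg] and [P_pos]. *)
Let P (x : R -> 'cV[R]_n) (t : R) : 'cV[R]_n :=
  x0 t + \sum_j A j *m (x (Num.max 0 t - d j) - x0 (- d j)) + Z x (Num.max 0 t).

Let max0_cont : continuous (fun t : R => Num.max 0 t).
Proof.
apply: continuous_of_lipschitz => T; exists 1 => // s t _ _; rewrite mul1r.
exact: ler_dist_max.
Qed.

Let P_cont (x : R -> 'cV[R]_n) : continuous x -> continuous (P x).
Proof.
move=> cx; have [_ lZ _] := ZP cx.
move=> t; apply: cvgD; first apply: cvgD; first exact: x0_cont.
  apply: continuous_sum => j; apply: continuous_mulmx.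
  have c1 : continuous (fun t : R => Num.max 0 t - d j).
    by move=> s; apply: cvgB; [exact: max0_cont|exact: cvg_cst].
  have c2 : continuous (fun t : R => x (Num.max 0 t - d j)).
    by move=> s; apply: (continuous_comp (c1 s)); exact: cx.
  by move=> s; apply: cvgB; [exact: c2|exact: cvg_cst].
move: t; apply: continuous_of_lipschitz => T; have [C C0 h] := lZ `|T|.
exists C => // s t sT tT.
have max_le (r : R) : `|r| <= T -> 0 <= Num.max 0 r /\ Num.max 0 r <= `|T|.
  move=> rT; have T0 : 0 <= T by exact: le_trans rT.
  rewrite le_max lexx ge_max normr_ge0 (ger0_norm T0).
  by split => //; apply: le_trans rT; exact: ler_norm.
have [s0 s1] := max_le s sT; have [t0 t1] := max_le t tT.
apply: (le_trans (h _ _ s0 s1 t0 t1)); rewrite ler_wpM2l//.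
exact: ler_dist_max.
Qed.

Let P_neg (x : R -> 'cV[R]_n) : continuous x -> (forall s : R, s <= 0 -> x s = x0 s) ->
  forall t : R, t <= 0 -> P x t = x0 t.
Proof.
move=> cx xn t t0; have [Z0 _ _] := ZP cx.
rewrite /P max_l// Z0 addr0 big1 ?addr0// => j _.
have /andP[dj _] := d_bounds j.
by rewrite sub0r xn ?subrr ?mulmx0// oppr_le0 ltW.
Qed.

Let P_pos (x : R -> 'cV[R]_n) (t : R) : 0 <= t ->
  P x t = \sum_j A j *m x (t - d j) + (Dxi + Z x t).
Proof.
move=> t0; rewrite /P max_r// (x0_pos t0) /Dxi (x0_pos (lexx 0)).
under eq_bigr => j _ do rewrite mulmxBr.
by rewrite sumrB; apply/matrixP => i j; rewrite !mxE; ring.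
Qed.

Let Z_ac (x : R -> 'cV[R]_n) (T : R) : continuous x -> absolutely_continuous 0 T (Z x).
Proof.
move=> cx; have [_ lZ _] := ZP cx; have [C _ h] := lZ T.
exact: lipschitz_absolutely_continuous h.
Qed.

Let X (k : nat) := iter k P x0.

Let X_cont k : continuous (X k).
Proof. by elim: k => [|k IH]; [exact: x0_cont|exact: P_cont]. Qed.

Let X_neg k (t : R) : t <= 0 -> X k t = x0 t.
Proof. by elim: k t => [//|k IH] t t0; apply: P_neg => //; exact: X_cont. Qed.

(** By induction |X_k(s)| <= B e^(q s) on [-Delta, T]: [neutral_estimate] returns
    (B/2) e^(q s) + |D xi| + c T, where c bounds L(|v|), and B is chosen so that
    B/2 absorbs the last two terms. *)
Let X_bounded (T : R) : 0 <= T ->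
  exists2 H : R, 0 < H & forall k (s : R), s <= T -> `|X k s| <= H.
Proof.
move=> T0; have [h h0 hd] := min_delay (fun j => (andP (d_bounds j)).1).
have hdD j : h <= d j <= Delta by rewrite hd/=; have /andP[] := d_bounds j.
have K0 : 0 <= L0 * n%:R by rewrite mulr_ge0.
have [q q0 hq] := rate_exists h0 (delay_gain_ge0 A) K0.
have [C vC] := v_bounded T.
pose c := L (Num.max 0 C).
have c0 : 0 <= c by apply: L_ge0; rewrite le_max lexx.
have B0 : 0 <= supnorm Delta xi by exact: supnorm_ge0.
(* The factor e^(q Delta) compensates for the weight on [-Delta, 0]. *)
pose B := supnorm Delta xi * expR (q * Delta) + 2 * (`|Dxi| + c * T).
have cT : 0 <= c * T by rewrite mulr_ge0.
have BB : 0 <= B by rewrite /B addr_ge0 ?mulr_ge0 ?expR_ge0// addr_ge0.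
have x0B s : - Delta <= s -> `|x0 s| <= B * expR (q * s).
  move=> Ds; apply: (le_trans (x0_bounded s)).
  apply: (@le_trans _ _ (supnorm Delta xi * expR (q * Delta) * expR (q * s))).
    rewrite -mulrA ler_peMr// -expRD -expR0 ler_expR -mulrDr.
    by rewrite (mulr_ge0 (ltW q0))//; lra.
  rewrite ler_wpM2r ?expR_ge0// /B lerDl mulr_ge0// addr_ge0//.
have XB k s : - Delta <= s -> s <= T -> `|X k s| <= B * expR (q * s).
  elim: k s => [|k IH] s Ds sT; first exact: x0B.
  have [s0|/ltW s0] := leP 0 s; last by rewrite X_neg//; exact: x0B.
  have [Z0 _ dZ] := ZP (@X_cont k).
  have := @neutral_estimate R n p A d Delta h (L0 * n%:R) q B c s (X k)
    (fun t => Dxi + Z (X k) t) (X k.+1 s) h0 hdD K0 q0 hq BB c0 s0.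
  rewrite Z0 addr0 => H; apply: le_trans (H _ _ _ _) _.
  - by move=> r Dr rs; apply: IH => //; exact: le_trans sT.
  - exact: P_pos.
  - by apply: absolutely_continuous_cstD; apply: Z_ac; exact: X_cont.
  - apply: filterS dZ => r dr r0 rs; have {}dr := dr r0.
    exists (f (hist (X k) r) (v r)).
      by rewrite -[X in is_derive _ _ _ X]add0r; apply: is_deriveD.
    apply: (le_trans (mxnorm_le_enorm _)).
    apply: (le_trans (f_growth _ (continuous_histC (@X_cont k)))); apply: lerD.
      rewrite -mulrA ler_wpM2l//; apply: supnorm_le_mxnorm => // tau /andP[t1 t2].
      rewrite /hist; apply: (le_trans (IH _ _ _)); [lra|lra|].
      by rewrite ler_wpM2l// ler_expR (ler_wpM2l (ltW q0))//; lra.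
    apply: L_mono; first exact: enorm_ge0.
    by rewrite le_max vC ?orbT// ger0_norm//; lra.
  - have e1 : 1 <= expR (q * s) by rewrite -expR0 ler_expR mulr_ge0// ltW.
    have h1 : c * s <= c * T by rewrite ler_wpM2l.
    have h2 : (`|Dxi| + c * T) <= B / 2.
      have : 0 <= supnorm Delta xi * expR (q * Delta) by rewrite mulr_ge0// expR_ge0.
      by rewrite /B; lra.
    have h3 : B / 2 <= B / 2 * expR (q * s) by rewrite ler_peMr// divr_ge0.
    lra.
exists (B * expR (q * T) + supnorm Delta xi + 1).
  by rewrite ltr_wpDl// addr_ge0// mulr_ge0// expR_ge0.
move=> k s sT; have e0 : 0 <= B * expR (q * T) by rewrite mulr_ge0// expR_ge0.
have [s0|/ltW s0] := leP 0 s; last first.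
  by rewrite X_neg//; have := x0_bounded s; lra.
have : B * expR (q * s) <= B * expR (q * T).
  by rewrite ler_wpM2l// ler_expR (ler_wpM2l (ltW q0)).
have Ds : - Delta <= s by rewrite (le_trans _ s0)// oppr_le0.
by have := XB k s Ds sT; lra.
Qed.

(** On functions bounded by H up to time T the operator is a contraction with
    factor 1/2 for an exponential weight; the Lipschitz constant of f on the
    ball, and with it the exponent q, depends on H and T. *)
Let P_contract (T H : R) : 0 <= T -> 0 < H -> exists2 q : R, 0 < q &
  forall (x y : R -> 'cV[R]_n) (S : R), continuous x -> continuous y -> 0 <= S ->
    (forall s : R, s <= 0 -> x s = x0 s) -> (forall s : R, s <= 0 -> y s = x0 s) ->
    (forall s : R, s <= T -> `|x s| <= H) -> (forall s : R, s <= T -> `|y s| <= H) ->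
    (forall s : R, 0 <= s -> s <= T -> `|x s - y s| <= S * expR (q * s)) ->
    forall s : R, 0 <= s -> s <= T -> `|P x s - P y s| <= S / 2 * expR (q * s).
Proof.
move=> T0 H0; have [h h0 hd] := min_delay (fun j => (andP (d_bounds j)).1).
have hdD j : h <= d j <= Delta by rewrite hd/=; have /andP[] := d_bounds j.
have [C vC] := v_bounded T.
have [||Lam Lam0 hLam] := @f_lip (n%:R * H + 1) (Num.max 0 C + 1).
- by rewrite ltr_wpDl// mulr_ge0// ltW.
- by rewrite ltr_wpDl// le_max lexx.
have K0 : 0 <= Lam * n%:R by rewrite mulr_ge0// ltW.
have [q q0 hq] := rate_exists h0 (delay_gain_ge0 A) K0.
exists q => // x y S cx cy S0 xn yn xH yH xyS s s0 sT.
have [Zx0 _ dZx] := ZP cx; have [Zy0 _ dZy] := ZP cy.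
have xyS' r : - Delta <= r -> r <= s -> `|x r - y r| <= S * expR (q * r).
  move=> Dr rs; have [r0|/ltW r0] := leP 0 r;
    first by apply: xyS => //; exact: le_trans sT.
  by rewrite xn// yn// subrr normr0 mulr_ge0// expR_ge0.
have := @neutral_estimate R n p A d Delta h (Lam * n%:R) q S 0 s (fun r => x r - y r)
    (fun t => Z x t - Z y t) (P x s - P y s) h0 hdD K0 q0 hq S0 (lexx 0) s0 xyS'.
rewrite Zx0 Zy0 subrr normr0 mul0r !addr0; apply.
- rewrite !P_pos//; under [in RHS]eq_bigr => j _ do rewrite mulmxBr.
  by rewrite sumrB; apply/matrixP => i j; rewrite !mxE; ring.
- by apply: absolutely_continuousB; exact: Z_ac.
apply: filterS2 dZx dZy => r dx dy r0 rs; have {}dx := dx r0; have {}dy := dy r0.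
exists (f (hist x r) (v r) - f (hist y r) (v r)); first exact: is_deriveB.
have bnd (w : R -> 'cV[R]_n) : continuous w -> (forall s : R, s <= T -> `|w s| <= H) ->
    supnorm Delta (hist w r) <= n%:R * H + 1.
  move=> cw wH; apply: (@le_trans _ _ (n%:R * H)); last by rewrite lerDl.
  by apply: supnorm_le_mxnorm => // tau /andP[? ?]; apply: wH; lra.
have vb : enorm (v r) <= Num.max 0 C + 1.
  apply: (@le_trans _ _ C); first by apply: vC; rewrite ger0_norm//; lra.
  by apply: (@le_trans _ _ (Num.max 0 C)); [rewrite le_max lexx orbT|rewrite lerDl].
rewrite addr0; apply: (le_trans (mxnorm_le_enorm _)).
apply: (le_trans (hLam _ _ _ _ (continuous_histC cx) (continuous_histC cy)
  (bnd x cx xH) (bnd y cy yH) vb vb)).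
rewrite subrr enorm0 addr0 -mulrA (ler_wpM2l (ltW Lam0))//.
apply: supnorm_le_mxnorm => // tau /andP[t1 t2]; rewrite /hist/=.
apply: (le_trans (xyS' _ _ _)); [lra|lra|].
by rewrite ler_wpM2l// ler_expR (ler_wpM2l (ltW q0))//; lra.
Qed.

Let X_geometric (T : R) : 0 <= T -> exists2 C : R, 0 <= C &
  forall k (s : R), s <= T -> `|X k.+1 s - X k s| <= C * 2^-1 ^+ k.
Proof.
move=> T0; have [H H0 XH] := X_bounded T0; have [q q0 hq] := P_contract T0 H0.
have XS k s : 0 <= s -> s <= T ->
    `|X k.+1 s - X k s| <= 2 * H * 2^-1 ^+ k * expR (q * s).
  elim: k s => [|k IH] s s0 sT.
    rewrite expr0 mulr1; apply: (@le_trans _ _ (2 * H)).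
      by rewrite (le_trans (ler_normB _ _))//;
        have := XH 0%N s sT; have := XH 1%N s sT; lra.
    have HH : 0 <= 2 * H by rewrite mulr_ge0// ltW.
    by rewrite ler_peMr// -expR0 ler_expR (mulr_ge0 (ltW q0)).
  rewrite exprSr mulrA.
  have p0 : 0 <= 2 * H * 2^-1 ^+ k by rewrite !mulr_ge0 ?exprn_ge0// ltW.
  exact: (hq (X k.+1) (X k) _ (@X_cont k.+1) (@X_cont k) p0 (@X_neg k.+1) (@X_neg k)
    (XH k.+1) (XH k) (IH)).
exists (2 * H * expR (q * T)); first by rewrite !mulr_ge0 ?expR_ge0// ltW.
move=> k s sT; have p0 : 0 <= 2 * H * 2^-1 ^+ k by rewrite !mulr_ge0 ?exprn_ge0// ltW.
have [s0|/ltW s0] := leP 0 s; last first.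
  by rewrite !X_neg// subrr normr0 mulrAC mulr_ge0// expR_ge0.
apply: (le_trans (XS k s s0 sT)); rewrite [leRHS]mulrAC.
by rewrite ler_wpM2l// ler_expR (ler_wpM2l (ltW q0)).
Qed.

Let limit_exists (s : R) : exists l, forall C,
  (forall k, `|X k.+1 s - X k s| <= C * 2^-1 ^+ k) ->
  forall k, `|X k s - l| <= 2 * C * 2^-1 ^+ k.
Proof.
apply: geometric_limit; have [C _ h] := X_geometric (normr_ge0 s).
by exists C => k; apply: h; exact: ler_norm.
Qed.

Let x (s : R) := sval (cid (limit_exists s)).

Let X_x (T : R) : 0 <= T -> exists2 C : R, 0 <= C &
  forall k (s : R), s <= T -> `|X k s - x s| <= C * 2^-1 ^+ k.
Proof.
move=> /X_geometric[C C0 h]; exists (2 * C); first by rewrite mulr_ge0.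
by move=> k s sT; apply: (svalP (cid (limit_exists s))) => j; exact: h.
Qed.

Let x_neg (s : R) : s <= 0 -> x s = x0 s.
Proof.
move=> s0; have [C _ h] := X_x (lexx 0); apply/eqP; rewrite eq_sym -subr_eq0 -normr_le0.
by apply: (@le_add_geometric _ _ _ C) => k; rewrite add0r -(X_neg k s0) h.
Qed.

Let x_cont : continuous x.
Proof.
apply/continuous_epsP => s e e0.
have T0 : 0 <= `|s| + 1 by rewrite addr_ge0.
have [C C0 h] := X_x T0.
have eC0 : 0 < e / (4 * (C + 1)) by rewrite divr_gt0// mulr_gt0//; lra.
have [k _ hk] := near_infty_natSinv_expn_lt (PosNum eC0).
have {hk} := hk k (leqnn k); rewrite /= div1r -exprVn => hk.
have Ck : C * 2^-1 ^+ k <= e / 4.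
  apply: (@le_trans _ _ ((C + 1) * (e / (4 * (C + 1))))).
    by apply: ler_pM; [by []|by rewrite exprn_ge0|lra|exact: ltW].
  by rewrite le_eqVlt; apply/orP; left; apply/eqP; field; lra.
have /continuous_epsP /(_ s (e / 2)) := @X_cont k.
move=> /(_ ltac:(lra)) [eta eta0 Xe].
exists (Num.min eta 1); first by rewrite lt_min eta0 ltr01.
move=> t; rewrite lt_min => /andP[/Xe te /ltr_normlP[t1 t2]].
have s1 : s <= `|s| + 1 by rewrite (le_trans (ler_norm s))// lerDl.
have t3 : t <= `|s| + 1.
  by apply: (@le_trans _ _ (s + 1)); [lra|rewrite lerD2r ler_norm].
apply: (le_trans (ler_distD (X k t) _ _)).
apply: (@le_trans _ _ (e / 4 + (e / 2 + e / 4))); last by lra.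
apply: lerD; first by rewrite distrC (le_trans (h k t t3)).
apply: (le_trans (ler_distD (X k s) _ _)); apply: lerD => //.
exact: (le_trans (h k s s1)).
Qed.

(** P x and X_(k+1) = P X_k are close by contraction, X_(k+1) and x by
    convergence. *)
Let x_fixed (s : R) : 0 <= s -> P x s = x s.
Proof.
move=> s0; have [C C0 h] := X_x s0; have [H H0 XH] := X_bounded s0.
have xH t : t <= s -> `|x t| <= H.
  move=> ts; apply: (@le_add_geometric _ _ _ C) => k.
  rewrite -(subrK (X k t) (x t)) addrC (le_trans (ler_normD _ _))// lerD ?XH//.
  by rewrite distrC h.
have [q q0 hq] := P_contract s0 H0.
apply/eqP; rewrite -subr_eq0 -normr_le0.
apply: (@le_add_geometric _ _ _ (C / 2 * expR (q * s) + C)) => k; rewrite add0r.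
have pk : 0 <= C * 2^-1 ^+ k by rewrite mulr_ge0// exprn_ge0.
have h1 : `|P x s - P (X k) s| <= C * 2^-1 ^+ k / 2 * expR (q * s).
  apply: (hq x (X k) _ x_cont (@X_cont k) pk x_neg (@X_neg k) xH (XH k)) => //.
  move=> t t0 ts; rewrite distrC (le_trans (h k t ts))// ler_peMr//.
  by rewrite -expR0 ler_expR mulr_ge0// ltW.
have h2 := h k.+1 s (lexx s); rewrite exprSr in h2.
rewrite -(subrKA (P (X k) s)) (le_trans (ler_normD _ _))//.
rewrite -[P (X k)]/(X k.+1) in h1 *; lra.
Qed.

(** The fixed point satisfies D x_t = D xi + Z x t for t >= 0, and Z x is an
    antiderivative of f(x_t, v(t)). *)
Lemma picard_solution : exists y, is_solution Delta A d f v xi +oo y.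
Proof.
exists x; have [Z0 lZ dZ] := ZP x_cont.
have DE t : 0 <= t -> Dxi + Z x t = Dop A d (hist x t).
  move=> t0; rewrite /Dop /hist addr0 -[in RHS](x_fixed t0) P_pos//.
  by rewrite [RHS]addrAC subrr add0r.
split.
- exact: continuous_subspaceT.
- by move=> t; rewrite in_itv/= => tD; rewrite x_neg ?x0_xi//; have /andP[] := tD.
- move=> c c0 _; apply: (@eq_absolutely_continuous _ _ _ _ (fun t => Dxi + Z x t)).
    by move=> t t0 _; exact: DE.
  by apply: absolutely_continuous_cstD; exact: Z_ac x_cont.
(* The identity for D x_t holds on t >= 0 only, whence a two-sided
   derivative at t > 0. *)
- apply: filterS2 dZ (ae_neq 0) => t dt /eqP t_neq0 t0 _.
  have t_gt0 : 0 < t by rewrite lt_neqAle eq_sym t_neq0.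
  apply: (@near_is_derive _ _ (fun s => Dxi + Z x s) _ t _ t t_gt0).
    by move=> s /ltr_normlP[s1 s2]; apply: DE; lra.
  have {}dt := dt t0.
  by rewrite -[X in is_derive _ _ _ X]add0r; apply: is_deriveD.
Qed.

End picard.

(** * Comparison functions *)

Section comparison_functions.
Context {R : realType}.

Lemma classK_ge0 (g : R -> R) (r : R) : classK g -> 0 <= r -> 0 <= g r.
Proof.
move=> [_ g0 ginc]; rewrite le_eqVlt => /predU1P[<-|r0]; first by rewrite g0.
by rewrite -g0 ltW// ginc.
Qed.

Lemma classK_le (g : R -> R) (r s : R) : classK g -> 0 <= r -> r <= s -> g r <= g s.
Proof.
move=> [_ g0 ginc] r0; rewrite le_eqVlt => /predU1P[->//|rs].
by rewrite ltW// ginc.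
Qed.

Lemma classKZ (c : R) (g : R -> R) : 0 < c -> classK g -> classK (fun r => c * g r).
Proof.
move=> c0 [/within_continuousP cg g0 ginc]; split.
- apply/within_continuousP => s s0 e e0.
  have [eta eta0 h] := cg s s0 _ (divr_gt0 e0 c0); exists eta => // t t0 ts.
  rewrite -mulrBr normrM (ger0_norm (ltW c0)) mulrC -ler_pdivlMr//.
  exact: h.
- by rewrite g0 mulr0.
- by move=> s t s0 st; rewrite ltr_pM2l// ginc.
Qed.

Lemma classK_id : classK (@idfun R).
Proof. by split => //; apply: continuous_subspaceT => t; exact: cvg_id. Qed.

Lemma continuous_exp_decay (c q : R) : continuous (fun t : R => c * expR (- q * t)).
Proof.
move=> t; apply: differentiable_continuous; apply/derivable1_diffP; apply: ex_derive.
Qed.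

(** Decay to 0 follows from c s e^(-q t) <= c s / (1 + q t). *)
Lemma classKL_exponential (c q : R) : 0 < c -> 0 < q ->
  classKL (fun s t => c * expR (- q * t) * s).
Proof.
move=> c0 q0; split=> [t t0|s s0].
  by apply: classKZ classK_id; rewrite mulr_gt0// expR_gt0.
split.
- apply/within_continuousP => t t0 e e0.
  have q1 : 0 < s + 1 by lra.
  have /continuous_epsP /(_ t _ (divr_gt0 e0 q1))[eta eta0 h] :=
    @continuous_exp_decay c q.
  exists eta => // r r0 /h hr; rewrite -mulrBl normrM (ger0_norm s0).
  move: hr; rewrite ler_pdivlMr// => hr; apply: le_trans hr.
  by rewrite ler_wpM2l// lerDl.
- move=> t r t0 tr; rewrite ler_wpM2r// (ler_wpM2l (ltW c0))// ler_expR.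
  by rewrite !mulNr lerN2 (ler_wpM2l (ltW q0)).
- apply/cvgrPdist_le => e e0.
  apply: filterS (nbhs_pinfty_ge (num_real (c * s / (q * e)))) => t ht.
  have cs0 : 0 <= c * s by rewrite mulr_ge0// ltW.
  have t0 : 0 <= t by apply: le_trans ht; rewrite divr_ge0// mulr_ge0// ltW.
  have E0 : 0 < expR (q * t) by exact: expR_gt0.
  rewrite sub0r normrN mulNr expRN mulrAC ger0_norm; last first.
    by rewrite mulr_ge0// invr_ge0 ltW.
  rewrite ler_pdivrMr//; apply: (@le_trans _ _ (e * (1 + q * t))).
    by move: ht; rewrite ler_pdivrMr ?mulr_gt0//; lra.
  by rewrite (ler_wpM2l (ltW e0))// expR_ge1Dx.
Qed.

End comparison_functions.

(** * The theorem *)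

Section main.
Context {R : realType} {n m p : nat}.
Notation mu := (@lebesgue_measure R).

Lemma field_lipschitz (Delta : R) (f : (R -> 'cV[R]_n) -> 'cV[R]_m -> 'cV[R]_n)
    (L0 : R) (L : R -> R) :
  (forall phi1 phi2, histC Delta phi1 -> histC Delta phi2 ->
     enorm (f phi1 0 - f phi2 0) <= L0 * supnorm Delta (phi1 \- phi2)) ->
  (forall phi u, histC Delta phi -> enorm (f phi u - f phi 0) <= L (enorm u)) ->
  forall phi1 phi2 u, histC Delta phi1 -> histC Delta phi2 ->
    enorm (f phi1 u - f phi2 0) <= L0 * supnorm Delta (phi1 \- phi2) + L (enorm u).
Proof.
move=> h1 h2 phi1 phi2 u c1 c2.
rewrite -(subrKA (f phi1 0)) (le_trans (enormD _ _))// addrC.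
by rewrite lerD ?h1 ?h2.
Qed.

(** A solution for the Borel representative of the input is a solution for the
    input itself, since the equation is required almost everywhere only. *)
Lemma solution_exists (Delta : R) (d : 'I_p -> R) (A : 'I_p -> 'M[R]_n)
    (f : (R -> 'cV[R]_n) -> 'cV[R]_m -> 'cV[R]_n) (L0 : R) (L : R -> R) :
  0 < Delta -> (forall j, 0 < d j <= Delta) -> lip_on_bounded Delta f ->
  f (fun=> 0) 0 = 0 -> 0 <= L0 -> classK L ->
  (forall phi1 phi2 u, histC Delta phi1 -> histC Delta phi2 ->
     enorm (f phi1 u - f phi2 0) <= L0 * supnorm Delta (phi1 \- phi2) + L (enorm u)) ->
  forall xi u, histC Delta xi -> input u ->
  exists x, is_solution Delta A d f u xi +oo x.
Proof.
move=> D0 dD lf f00 L00 KL fL xi u cxi iu.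
have [v [mv bv vu]] := borel_version iu.
have growth phi w : histC Delta phi ->
    enorm (f phi w) <= L0 * supnorm Delta phi + L (enorm w).
  move=> cphi; have c0 : histC Delta (fun=> 0 : 'cV[R]_n).
    by apply: continuous_subspaceT; exact: cst_continuous.
  have := fL phi (fun=> 0) w cphi c0; rewrite f00 subr0.
  by rewrite (_ : phi \- _ = phi)//; apply/funext => t /=; rewrite subr0.
have [x [cx xxi acx dx]] := picard_solution D0 dD A lf L00
  (fun r => classK_ge0 KL) (fun r s => classK_le KL) growth mv bv cxi.
exists x; split => //; apply: filterS2 dx vu => t dxt vut t0 tb.
by rewrite -vut//; exact: dxt.
Qed.

End main.

Theorem theorem5 (R : realType) (n m p : nat)
  (n_gt0 : (0 < n)%N) (m_gt0 : (0 < m)%N) (p_gt0 : (0 < p)%N)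
  (Delta : R) (Delta_gt0 : 0 < Delta)
  (d : 'I_p -> R) (d_bounds : forall j, 0 < d j <= Delta)
  (A : 'I_p -> 'M[R]_n)
  (f : (R -> 'cV[R]_n) -> 'cV[R]_m -> 'cV[R]_n)
  (f_lip : lip_on_bounded Delta f)
  (f00 : f (fun=> 0) 0 = 0)
  (D_strongly_stable : strongly_stable A)
  (f_fbar : exists2 fbar : 'cV[R]_n -> (R -> 'cV[R]_n) -> 'cV[R]_m -> 'cV[R]_n,
      indep_at0 Delta fbar &
      forall phi u, histC Delta phi -> f phi u = fbar (phi 0) phi u)
  (f_GES0 : GES0 Delta A d f)
  (f_hyp_i : exists2 L0 : R, 0 < L0 &
      forall phi1 phi2, histC Delta phi1 -> histC Delta phi2 ->
        enorm (f phi1 0 - f phi2 0) <= L0 * supnorm Delta (phi1 \- phi2))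
  (f_hyp_ii : exists2 L : R -> R, classK L &
      forall phi u, histC Delta phi ->
        enorm (f phi u - f phi 0) <= L (enorm u)) :
  ISS Delta A d f.
Proof.
have [L0 L00 fi] := f_hyp_i; have [L KL fii] := f_hyp_ii.
have fL := field_lipschitz fi fii.
have [C1 [C2 [q [C10 C20 q0 bound]]]] :=
  input_to_state_bound Delta_gt0 d_bounds (ltW L00) fL f_GES0.
exists (fun s t => C1 * expR (- q * t) * s), (fun r => C2 * L r); split.
- exact: classKL_exponential.
- exact: classKZ.
move=> xi u cxi iu; split.
  exact: (solution_exists A Delta_gt0 d_bounds f_lip f00 (ltW L00) KL fL cxi iu).
move=> b x b0 sx t t0 tb; have [r0 ur] := ess_norm_spec iu t0.
apply: (bound u xi b x _ t cxi sx _ t0 tb); first exact: classK_ge0.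
apply: filterS ur => s us s0 st.
by apply: classK_le => //; [exact: enorm_ge0|exact: us].
Qed.
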